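(* Let $p\in(1,\infty]$, so that the conjugate exponent satisfies $p^*\in[1,\infty)$, let $\boldsymbol{\gamma}=(\gamma_{\mathfrak{u}})_{\mathfrak{u}\subseteq\{1,2\}}$ be nonnegative weights, and let $\mathrm{QMC}_{2,n}$ be the QMC rule whose node set $\mathcal{P}=\{(x_j,y_j):j=1,\dots,n\}\subseteq[0,1)^2$ is projection regular, i.e. $\{x_j:j=1,\dots,n\}=\{y_j:j=1,\dots,n\}=\{j/n:j=0,\dots,n-1\}$. Then \[\mathrm{error}(\mathrm{QMC}_{2,n};\mathcal{F}_2)\le\frac1n\left[\frac{\gamma_{\{1\}}^{p^*}+\gamma_{\{2\}}^{p^*}}{p^*+1}+3^{p^*-1}\gamma_{\{1,2\}}^{p^*}\left(\frac{2}{(p^*+1)^2}+\big(nL_{p^*}(\mathcal{P})\big)^{p^*}\right)\right]^{1/p^*}.\] Moreover, there exists $C=C(p^* )>0$ such that for all $n$ and all such projection regular $\mathcal{P}$, \[\mathrm{error}(\mathrm{QMC}_{2,n};\mathcal{F}_2)\ge C\,\gamma_{\{1,2\}}\,L_{p^*}(\mathcal{P}).\]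
   Context: $1/p+1/p^*=1$. $\mathcal{U}_+=\{\mathfrak{u}\subseteq\{1,2\}:\gamma_{\mathfrak{u}}>0\}$. $K(x,t)=t$ if $x\ge t$, $t-1$ if $x<t$; $K_{\mathfrak{u}}(\boldsymbol{x}_{\mathfrak{u}},\boldsymbol{t}_{\mathfrak{u}})=\prod_{\ell\in\mathfrak{u}}K(x_\ell,t_\ell)$. The weighted ANOVA space $\mathcal{F}_2=\mathcal{F}_{2,p,\boldsymbol{\gamma}}=\bigoplus_{\mathfrak{u}\in\mathcal{U}_+}F_{\mathfrak{u}}$ with $F_\emptyset$ the constants (norm $|\cdot|$) and, for $\mathfrak{u}\neq\emptyset$, $F_{\mathfrak{u}}=\{\int h_{\mathfrak{u}}(\boldsymbol{t}_{\mathfrak{u}})K_{\mathfrak{u}}(\cdot_{\mathfrak{u}},\boldsymbol{t}_{\mathfrak{u}})\,\mathrm{d}\boldsymbol{t}_{\mathfrak{u}}: h_{\mathfrak{u}}\in L_p([0,1]^{|\mathfrak{u}|})\}$ with norm $\|h_{\mathfrak{u}}\|_{L_p}$; $\|f\|_{\mathcal{F}_2}=(\sum_{\mathfrak{u}\in\mathcal{U}_+}\gamma_{\mathfrak{u}}^{-p}\|f_{\mathfrak{u}}\|^p_{F_{\mathfrak{u}}})^{1/p}$ (max for $p=\infty$). QMC rule $\mathrm{QMC}_{2,n}(f)=\frac1n\sum_jf(x_j,y_j)$; worst case error $\sup_{\|f\|_{\mathcal{F}_2}\le1}|\int_{[0,1]^2}f-\mathrm{QMC}_{2,n}(f)|$.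 $L_{p^*}(\mathcal{P})=\|\Delta_{\mathcal{P}}\|_{L_{p^*}([0,1]^2)}$ with $\Delta_{\mathcal{P}}(t_1,t_2)=\frac1n\#\{j:x_j<t_1,\,y_j<t_2\}-t_1t_2$. *)

(* Defs.v *)
From HB Require Import structures.
From mathcomp Require Import all_boot all_order all_algebra.
From mathcomp Require Import all_classical all_reals all_analysis.
Set Implicit Arguments. Unset Strict Implicit. Unset Printing Implicit Defensive.
Import Order.TTheory GRing.Theory Num.Theory.
Import numFieldNormedType.Exports.
Local Open Scope classical_set_scope.
Local Open Scope ring_scope.

Section Defs.
Variable R : realType.

Definition leb1 := (@lebesgue_measure R).
Definition leb2 := (leb1 \x leb1)%E.

Definition I01 : set R := `[0, 1].
Definition I01sq : set (R * R) := I01 `*` I01.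

Definition Kker (x t : R) : R := if t <= x then t else t - 1.

Definition comp1 (h : R -> R) (x : R) : R :=
  Rintegral leb1 I01 (fun t => h t * Kker x t).
Definition comp12 (h : R * R -> R) (x y : R) : R :=
  Rintegral leb2 I01sq (fun t => h t * Kker x t.1 * Kker y t.2).

Definition Ffun (c : R) (h1 h2 : R -> R) (h12 : R * R -> R) (x y : R) : R :=
  c + comp1 h1 x + comp1 h2 y + comp12 h12 x y.

Definition Lp1 (p : \bar R) (h : R -> R) : \bar R :=
  Lnorm leb1 p (EFin \o (h \_ I01)).
Definition Lp2 (p : \bar R) (h : R * R -> R) : \bar R :=
  Lnorm leb2 p (EFin \o (h \_ I01sq)).

Definition inLp1 (p : \bar R) (h : R -> R) : Prop :=
  measurable_fun I01 h /\ (Lp1 p h < +oo)%E.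
Definition inLp2 (p : \bar R) (h : R * R -> R) : Prop :=
  measurable_fun I01sq h /\ (Lp2 p h < +oo)%E.

Definition wterm (r g N : R) : R := if 0 < g then (N / g) `^ r else 0.
Definition wmax (g N : R) : R := if 0 < g then N / g else 0.

(* the norm of F_{2,p,gamma} given the component norms N_u = ||f_u||_{F_u} *)
Definition Fnorm (p : \bar R) (g0 g1 g2 g12 N0 N1 N2 N12 : R) : R :=
  match p with
  | r%:E => (wterm r g0 N0 + wterm r g1 N1 + wterm r g2 N2 + wterm r g12 N12)
              `^ r^-1
  | +oo%E => Num.max (Num.max (wmax g0 N0) (wmax g1 N1))
                     (Num.max (wmax g2 N2) (wmax g12 N12))
  | -oo%E => 0
  end.

(* (c, h1, h2, h12) represents an element of the unit ball of F_2:
   components with gamma_u = 0 are absent, h_u in L_p, norm <= 1 *)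
Definition unit_ball_rep (p : \bar R) (g0 g1 g2 g12 : R)
    (c : R) (h1 h2 : R -> R) (h12 : R * R -> R) : Prop :=
  [/\ (g0 = 0 -> c = 0),
      (g1 = 0 -> forall t, h1 t = 0),
      (g2 = 0 -> forall t, h2 t = 0) &
      (g12 = 0 -> forall t, h12 t = 0)] /\
  [/\ inLp1 p h1, inLp1 p h2, inLp2 p h12 &
      Fnorm p g0 g1 g2 g12 `|c| (fine (Lp1 p h1)) (fine (Lp1 p h2))
        (fine (Lp2 p h12)) <= 1].

Definition QMC2 (n : nat) (x y : 'I_n -> R) (f : R -> R -> R) : R :=
  n%:R^-1 * \sum_(j < n) f (x j) (y j).

Definition wc_error (p : \bar R) (g0 g1 g2 g12 : R) (n : nat) (x y : 'I_n -> R)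
  : \bar R :=
  ereal_sup [set e : \bar R | exists c h1 h2 h12,
     unit_ball_rep p g0 g1 g2 g12 c h1 h2 h12 /\
     e = (`| Rintegral leb2 I01sq (fun z => Ffun c h1 h2 h12 z.1 z.2)
             - QMC2 x y (Ffun c h1 h2 h12) |)%:E].

Definition proj_regular (n : nat) (x y : 'I_n -> R) : Prop :=
  range x = [set (k%:R / n%:R : R) | k in `I_n] /\
  range y = [set (k%:R / n%:R : R) | k in `I_n].

Definition discr (n : nat) (x y : 'I_n -> R) (t : R * R) : R :=
  (\sum_(j < n) ((x j < t.1) && (y j < t.2))%:R) / n%:R - t.1 * t.2.
Definition Ldisc (q : R) (n : nat) (x y : 'I_n -> R) : R :=
  fine (Lp2 q%:E (discr x y)).

Definition pstar (p : \bar R) : R :=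
  match p with
  | r%:E => r / (r - 1)
  | +oo%E => 1
  | -oo%E => 0
  end.

End Defs.

(* Main.v *)
Require Import Defs.
From HB Require Import structures.
From mathcomp Require Import all_boot all_order all_algebra.
From mathcomp Require Import all_classical all_reals all_analysis.
From mathcomp Require Import measurable_realfun ess_sup_inf ring lra zify.
Set Implicit Arguments. Unset Strict Implicit. Unset Printing Implicit Defensive.
Import Order.TTheory GRing.Theory Num.Theory.
Import numFieldNormedType.Exports.
Local Open Scope classical_set_scope.
Local Open Scope ring_scope.

(* Since [K(., t)] has mean zero, the error of the rule at [f] is
   [- (<h1, D1> + <h2, D1> + <h12, D12>)], where [D1 t = t - #{k < n : k/n < t}/n]
   and [D12 (t1, t2) = Delta (t1, t2) + t1 * D1 t2 + t2 * D1 t1]: projection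
   regularity makes both one-dimensional terms equal to the sawtooth [D1].  Hoelder's
   inequality, the explicit norm of [D1] and the convexity of [u ^ q] give the upper
   bound.  For the lower bound, duality gives the error at least
   [gamma12 * ||D12||_q], and [||Delta||_q] is at most a multiple of
   [||D12||_q + 1/n], so one needs [||D12||_q >= c/n].  For [n = 1] this is explicit
   as [D12 = (t1 - 1) * (t2 - 1)]; for [n >= 2] it holds because shifting
   [t2] by [1/n] changes [D12 (t1, t2)] by [(d - C t1)/n], where [d] is 0 or 1 and
   [C t1 = t1 - D1 t1] stays in [[1/4, 3/4]] for [t1] in [[1/4, 1/2]]. *)

(** * Hoelder's inequality and its extremal functions on a set of measure one *)

(** Passing between [Delta] and [D12] costs the terms [t1 * D1 t2] and [t2 * D1 t1], whose norms are
    exactly of order [1/n] and do not depend on how the coordinates are paired. In the upper bound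
    this cost is visible in the claim; in the lower bound it must be absorbed, and a priori [Delta]
    could nearly cancel these terms. Integrality prevents it: over one grid step [n * D12] changes
    by an integer minus a number bounded away from the integers, so [|D12|] cannot be below [1/(8n)]
    at both ends of the step. As the admissible pairs [(t1, t2)] fill a region of fixed area, the
    resulting constant depends on [q] only. The functions [h] are merely in [L_p], but all kernels
    are bounded. On a space of measure one this makes [h] integrable, which suffices for Fubini's
    theorem to transfer the mean-zero property of [K] to each component. *)

Lemma pstar_ge1 (R : realType) (p : \bar R) : (1%:E < p)%E -> 1 <= pstar p.
Proof.
case: p => [r| |] //=; rewrite lte_fin => r1.
by rewrite ler_pdivlMr ?subr_gt0// mul1r gerBl.
Qed.

Section normalized_domain.
Context {d : measure_display} {T : measurableType d} {R : realType}.
Variables (mu : {measure set T -> \bar R}) (D : set T).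
Hypotheses (mD : measurable D) (muD : mu D = 1%E).
Implicit Types (f g h : T -> R) (q : R) (p : \bar R).

(** The [q]-th power of the norm. Bounds are proved for it, and roots are taken only when the
    worst-case error is assembled. *)
Definition intpow q g : R := \int[mu]_(x in D) (`|g x| `^ q).

Lemma intpow_ge0 q g : 0 <= intpow q g.
Proof. by apply: Rintegral_ge0 => x _; exact: powR_ge0. Qed.

Lemma integrable_bounded f (M : R) : measurable_fun D f ->
  (forall x, D x -> `|f x| <= M) -> mu.-integrable D (EFin \o f).
Proof.
move=> mf fM; apply: measurable_bounded_integrable => //.
  by rewrite muD ltry.
exists M; split; first exact: num_real.
by move=> y My x Dx; apply: le_trans (fM _ Dx) (ltW My).
Qed.

Lemma measurable_normr_powR f q : measurable_fun D f ->
  measurable_fun D (fun x => `|f x| `^ q).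
Proof.
move=> mf; apply: (@measurableT_comp _ _ _ _ _ _ (@powR R ^~ q)) => //.
exact: measurableT_comp.
Qed.

Lemma integrable_normr_powR f (M : R) q : 0 <= q -> measurable_fun D f ->
  (forall x, D x -> `|f x| <= M) ->
  mu.-integrable D (fun x => (`|f x| `^ q)%:E).
Proof.
move=> q0 mf fM; apply: (@integrable_bounded _ (`|M| `^ q)).
  exact: measurable_normr_powR.
move=> x Dx; rewrite ger0_norm ?powR_ge0// ge0_ler_powR// ?nnegrE//.
exact: le_trans (fM x Dx) (ler_norm _).
Qed.

Lemma Lnorm_restrict q g : 0 < q ->
  Lnorm mu q%:E (EFin \o (g \_ D)) =
  ((\int[mu]_(x in D) (`|g x| `^ q)%:E) `^ q^-1)%E.
Proof.
move=> q0; rewrite unlock [in RHS]integral_mkcond; congr (_ `^ _)%E.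
apply: eq_integral => x _; rewrite /= !patchE.
by case: ifPn => //= _; rewrite normr0 powR0// gt_eqF.
Qed.

Lemma fine_Lnorm_restrict q g : 0 < q ->
  fine (Lnorm mu q%:E (EFin \o (g \_ D))) = intpow q g `^ q^-1.
Proof. by move=> q0; rewrite Lnorm_restrict// fine_poweR. Qed.

Lemma measurable_restrict_setT h : measurable_fun D h ->
  measurable_fun setT (h \_ D).
Proof. by move=> mh; exact/(measurable_restrictT _ _).1. Qed.

(** The bound is on the extended integral of [|h * g|] because its finiteness is what yields
    integrability in [hoelder_integrable]. For [p = +oo] the conjugate exponent is 1, and [|h|] is
    bounded almost everywhere by its essential supremum. *)
Lemma hoelder_ge0 p h g (M : R) : (1%:E < p)%E ->
  measurable_fun D h -> (Lnorm mu p (EFin \o (h \_ D)) < +oo)%E ->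
  measurable_fun D g -> (forall x, D x -> `|g x| <= M) ->
  (\int[mu]_(x in D) `|h x * g x|%:E <=
   (fine (Lnorm mu p (EFin \o (h \_ D))) * intpow (pstar p) g `^ (pstar p)^-1)%:E)%E.
Proof.
move=> p1 mh hoo mg gM.
have mhg : measurable_fun D (fun x => `|h x * g x|).
  by apply: measurableT_comp => //; exact: measurable_funM.
have Lh0 := Lnorm_ge0 mu p (EFin \o (h \_ D)).
have iq : forall q, 0 <= q -> (\int[mu]_(x in D) (`|g x| `^ q)%:E = (intpow q g)%:E)%E.
  move=> q q0; rewrite /intpow /Rintegral fineK//.
  apply: integrable_fin_num => //; exact: integrable_normr_powR gM.
case: p p1 hoo Lh0 => [r| |] //= p1 hoo Lh0.
  rewrite lte_fin in p1.
  have r0 : 0 < r by rewrite (lt_trans ltr01).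
  have q0 : 0 < r / (r - 1) by rewrite divr_gt0// subr_gt0.
  rewrite EFinM fineK ?ge0_fin_numE//.
  have := hoelder mu (measurable_restrict_setT mh) (measurable_restrict_setT mg) r0 q0.
  rewrite (Lnorm_restrict _ q0) (iq _ (ltW q0)) Lnorm1 => H.
  apply: le_trans (H _); last first.
    by rewrite invf_div -{1}(div1r r) -mulrDl subrKC mulfV// gt_eqF.
  rewrite le_eqVlt integral_mkcond; apply/orP; left; apply/eqP.
  apply: eq_integral => x _ /=; rewrite !patchE.
  by case: ifPn => //= _; rewrite mulr0 normr0.
(* On a space of measure zero the norm at [+oo] is 0 by convention; [mu D = 1] excludes this. *)
have muT : (0 < mu setT)%E.
  by rewrite (lt_le_trans lte01)// -muD le_measure ?inE.
rewrite invr1 powRr1 ?intpow_ge0//.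
set N := fine _.
have hN : \forall x \ae mu, D x -> `|h x| <= N.
  have := ess_sup_ge mu (abse \o (EFin \o (h \_ D))).
  apply: filterS => x + Dx; rewrite /= patchE mem_set//= -lee_fin => /le_trans; apply.
  by rewrite /N fineK ?ge0_fin_numE// unlock muT.
rewrite EFinM -(iq 1)// -ge0_integralZl//; last 2 first.
- exact/measurable_EFinP/measurable_normr_powR.
- by rewrite lee_fin fine_ge0.
apply: ae_ge0_le_integral => //.
- exact/measurable_EFinP.
- by move=> x _; rewrite mule_ge0// lee_fin ?powR_ge0 ?fine_ge0.
- by apply/measurable_EFinP/measurable_funM => //; exact: measurable_normr_powR.
apply: filterS hN => x /[apply] hN.
by rewrite -EFinM lee_fin normrM powRr1// ler_wpM2r.
Qed.

Lemma hoelder_integrable p h g (M : R) : (1%:E < p)%E ->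
  measurable_fun D h -> (Lnorm mu p (EFin \o (h \_ D)) < +oo)%E ->
  measurable_fun D g -> (forall x, D x -> `|g x| <= M) ->
  mu.-integrable D (EFin \o (fun x => h x * g x)).
Proof.
move=> p1 mh hoo mg gM; apply/integrableP; split.
  by apply/measurable_EFinP; exact: measurable_funM.
by apply: le_lt_trans (hoelder_ge0 p1 mh hoo mg gM) _; rewrite ltry.
Qed.

Lemma Lp_integrable p h : (1%:E < p)%E ->
  measurable_fun D h -> (Lnorm mu p (EFin \o (h \_ D)) < +oo)%E ->
  mu.-integrable D (EFin \o h).
Proof.
move=> p1 mh hoo.
have := @hoelder_integrable p h (cst 1) 1 p1 mh hoo.
rewrite (_ : (fun x => h x * cst 1 x) = h).
  by apply; [exact: measurable_cst|move=> x _; rewrite normr1].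
by apply/funext => x; rewrite /= mulr1.
Qed.

Lemma hoelder_Rintegral p h g (M : R) : (1%:E < p)%E ->
  measurable_fun D h -> (Lnorm mu p (EFin \o (h \_ D)) < +oo)%E ->
  measurable_fun D g -> (forall x, D x -> `|g x| <= M) ->
  `| \int[mu]_(x in D) (h x * g x) | <=
   fine (Lnorm mu p (EFin \o (h \_ D))) * intpow (pstar p) g `^ (pstar p)^-1.
Proof.
move=> p1 mh hoo mg gM; rewrite -lee_fin EFin_normr_Rintegral//; last first.
  exact: (hoelder_integrable p1 mh hoo mg gM).
apply: le_trans (hoelder_ge0 p1 mh hoo mg gM).
apply: le_abse_integral => //; apply/measurable_EFinP; exact: measurable_funM.
Qed.

(* Equality case of Hoelder's inequality, scaled to have norm [gam]; at [q = 1] and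
   [g x = 0] the last factor is [0 `^ 0 = 1], and the sign makes the product vanish. *)
Definition extremal q (gam : R) g x : R :=
  gam * intpow q g `^ (q^-1 - 1) * (Num.sg (g x) * `|g x| `^ (q - 1)).

Lemma measurable_sgr : measurable_fun setT (@Num.sg R).
Proof.
rewrite (_ : @Num.sg R = fun x => if x < 0 then -1 else if 0 < x then 1 else 0).
  apply: measurable_fun_ifT => //; first exact: measurable_fun_ltr.
  by apply: measurable_fun_ifT => //; exact: measurable_fun_ltr.
by apply/funext => x; case: sgrP.
Qed.

Lemma measurable_extremal q gam g : measurable_fun D g ->
  measurable_fun D (extremal q gam g).
Proof.
move=> mg; apply: measurable_funM => //; apply: measurable_funM.
  exact: (measurableT_comp measurable_sgr).
exact: measurable_normr_powR.
Qed.

Lemma extremal_mul q gam g x : 1 <= q ->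
  extremal q gam g x * g x = gam * intpow q g `^ (q^-1 - 1) * `|g x| `^ q.
Proof.
move=> q1; rewrite /extremal -mulrA; congr (_ * _).
rewrite mulrAC -normrEsg mulr_powRB1//.
by rewrite (lt_le_trans ltr01).
Qed.

Lemma integral_extremal q gam g (M : R) : 1 <= q -> measurable_fun D g ->
  (forall x, D x -> `|g x| <= M) -> 0 < intpow q g ->
  \int[mu]_(x in D) (extremal q gam g x * g x) = gam * intpow q g `^ q^-1.
Proof.
move=> q1 mg gM A0.
have q0 : 0 <= q by rewrite (le_trans _ q1).
under eq_Rintegral do rewrite extremal_mul//.
rewrite RintegralZl//; last exact: integrable_normr_powR gM.
rewrite -/(intpow q g) -mulrA; congr (_ * _).
rewrite -{2}(powRr1 (ltW A0)) -powRD ?subrK//.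
by rewrite (gt_eqF A0) implybT.
Qed.

(** Conjugacy gives [(q - 1) * r = q] and [(q^-1 - 1) * r = -1], so with [A = intpow q g] the [r]-th
    power integrates to [gam ^ r * A^-1 * A]. For [p = +oo], where [q = 1], the function is just
    [gam] times the sign of [g]. *)
Lemma Lnorm_extremal p gam g (M : R) : (1%:E < p)%E -> 0 <= gam ->
  measurable_fun D g -> (forall x, D x -> `|g x| <= M) ->
  0 < intpow (pstar p) g ->
  (Lnorm mu p (EFin \o ((extremal (pstar p) gam g) \_ D)) <= gam%:E)%E.
Proof.
move=> p1 gam0 mg gM A0; have q1 := pstar_ge1 p1.
have mh := measurable_extremal (pstar p) gam mg.
case: p p1 q1 mh A0 => [r| |] //=; last first.
  move=> _ _ mh A0; rewrite unlock; case: ifPn => // mu0.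
  apply/ess_supP; apply: aeW => x; rewrite /= patchE.
  case: ifPn => [Dx|_]; last by rewrite normr0 lee_fin.
  rewrite lee_fin /extremal invr1 subrr !powRr0 !mulr1 normrM (ger0_norm gam0).
  by rewrite -[leRHS]mulr1 ler_wpM2l// normr_sg; case: (g x != 0).
rewrite lte_fin; set q := r / (r - 1) => r1 q1 mh A0.
have r0 : 0 < r by rewrite (lt_trans ltr01).
have r10 : r - 1 != 0 by rewrite subr_eq0 gt_eqF.
have q0 : 0 < q by rewrite (lt_le_trans ltr01).
rewrite Lnorm_restrict//.
have -> : (\int[mu]_(x in D) (`|extremal q gam g x| `^ r)%:E = (gam `^ r)%:E)%E.
  transitivity (\int[mu]_(x in D) ((gam `^ r * (intpow q g)^-1)%:E * (`|g x| `^ q)%:E))%E.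
    apply: eq_integral => x _; rewrite -EFinM; congr EFin.
    rewrite !normrM (ger0_norm gam0) !(ger0_norm (powR_ge0 _ _)).
    rewrite powRM ?mulr_ge0 ?powR_ge0// powRM ?powR_ge0//.
    congr (_ * _ * _).
      rewrite -powRrM (_ : _ * r = -1) ?powR_inv1 ?ltW//.
      by rewrite /q; field; rewrite r10 gt_eqF.
    have [->|gx0] := eqVneq (g x) 0.
      by rewrite sgr0 normr0 mul0r !powR0 ?gt_eqF.
    rewrite normr_sg gx0 mul1r -powRrM; congr (_ `^ _).
    by rewrite /q; field.
  rewrite integralZl//; last exact: integrable_normr_powR (ltW q0) mg gM.
  rewrite -[X in (_ * X)%E]fineK; last first.
    apply: integrable_fin_num => //; exact: integrable_normr_powR (ltW q0) mg gM.
  by rewrite -EFinM -/(Rintegral _ _ _) -/(intpow q g) divfK// gt_eqF.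
by rewrite poweR_EFin -powRrM mulfV ?gt_eqF// powRr1.
Qed.

End normalized_domain.

(** * Fubini's theorem for integral operators with a bounded kernel *)

Section bounded_kernel.
Context {d1 d2 : measure_display} {T1 : measurableType d1}
  {T2 : measurableType d2} {R : realType}.
Variables (m1 : {sigma_finite_measure set T1 -> \bar R})
  (m2 : {sigma_finite_measure set T2 -> \bar R}).
Variables (D : set T1) (E : set T2) (h : T2 -> R) (K : T1 * T2 -> R) (M : R).
Hypotheses (mD : measurable D) (mE : measurable E) (m1D : m1 D = 1%E).
Hypotheses (ih : m2.-integrable E (EFin \o h)) (mK : measurable_fun setT K)
  (KM : forall z t, D z -> E t -> `|K (z, t)| <= M).

(** Both domains are absorbed into the integrand, so that Fubini's theorem is applied on the full
    product. *)
Let f (zt : T1 * T2) : \bar R := (\1_D zt.1 * ((h \_ E) zt.2 * K zt))%:E.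

(** If [E] is empty, [KM] says nothing about the sign of [M]; the absolute value is a nonnegative
    bound in all cases. *)
Let M' : R := `|M|.

Let KM' z t : D z -> E t -> `|K (z, t)| <= M'.
Proof. by move=> Dz Et; apply: le_trans (KM Dz Et) (ler_norm _). Qed.

Let measurable_hE : measurable_fun setT (h \_ E).
Proof.
apply/(measurable_restrictT _ mE).1/measurable_EFinP.
exact: measurable_int ih.
Qed.

Let measurable_f : measurable_fun setT f.
Proof.
apply/measurable_EFinP/measurable_funM.
  by apply: (measurableT_comp _ measurable_fst); exact: measurable_indic.
by apply: measurable_funM => //; exact: (measurableT_comp _ measurable_snd).
Qed.

Let integrable_hE : m2.-integrable setT (EFin \o (h \_ E)).
Proof. by rewrite -restrict_EFin; exact/(integrable_mkcond _ mE).1. Qed.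

Let integrable_slice z : D z ->
  m2.-integrable E (EFin \o (fun t => h t * K (z, t))).
Proof.
move=> Dz.
have := @integrableMr _ _ _ m2 _ mE (fun t => K (z, t)) (EFin \o h).
rewrite (_ : (_ \* _)%E = EFin \o (fun t => h t * K (z, t))); last first.
  by apply/funext => t /=; rewrite -EFinM mulrC.
apply => //.
  apply: measurable_funTS; exact: measurable_fun_pair2.
exists M'; split; first exact: num_real.
by move=> y My t Et; apply: le_trans (KM' Dz Et) (ltW My).
Qed.

(** By Tonelli, integrating over [z] first: for fixed [t] the kernel is at most [M'] on a set of
    measure one, which leaves [M'] times the integral of [|h|]. *)
Let integrable_f : (m1 \x m2)%E.-integrable setT f.
Proof.
apply/integrable21ltyP => //.
apply: (@le_lt_trans _ _ (\int[m2]_t (M' * `|(h \_ E) t|)%:E)%E).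
  apply: ge0_le_integral => //.
  - by move=> t _; apply: integral_ge0.
  - apply: (measurable_fun_fubini_tonelli_G (abse \o f)).
      exact: measurableT_comp.
    by move=> x; exact: abse_ge0.
  - by apply/measurable_EFinP/measurable_funM => //; exact: measurableT_comp.
  move=> t _; apply: (@le_trans _ _ (\int[m1]_z (M' * `|(h \_ E) t| * \1_D z)%:E)%E).
    apply: ge0_le_integral => //.
    - apply: measurableT_comp => //; exact: (measurable_fun_pair1 _ measurable_f).
    - by apply/measurable_EFinP/measurable_funM => //; exact: measurable_indic.
    move=> z _; rewrite /f /= lee_fin indicE patchE.
    case: ifPn => [/set_mem Et|_]; last by rewrite mul0r mulr0 normr0 mulr0 mul0r.
    case: (boolP (z \in D)) => [/set_mem Dz|_]; last by rewrite mul0r mulr0 normr0.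
    by rewrite mul1r mulr1 normrM mulrC ler_wpM2r// KM'.
  under eq_integral do rewrite EFinM.
  rewrite ge0_integralZl//; last 2 first.
  - by apply/measurable_EFinP; exact: measurable_indic.
  - by rewrite lee_fin mulr_ge0 /M'.
  by rewrite integral_indic// setIT -[leRHS]mule1 (_ : _ D = 1%E).
under eq_integral do rewrite EFinM.
rewrite ge0_integralZl//; last 2 first.
- by apply/measurable_EFinP; exact: measurableT_comp.
- by rewrite lee_fin /M'.
have /integrableP[_] := integrable_hE.
by move=> hoo; rewrite lte_mul_pinfty// lee_fin /M'.
Qed.

Let fubini_F_kernel : fubini_F m2 f =
  (EFin \o (fun z => \int[m2]_(t in E) (h t * K (z, t)))) \_ D.
Proof.
apply/funext => z; rewrite /fubini_F patchE /f /=.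
case: ifPn => [/set_mem Dz|/negPf Dz]; last first.
  by rewrite integral0_eq// => t _; rewrite indicE Dz mul0r.
rewrite /= /Rintegral fineK; last by apply: integrable_fin_num => //; exact: integrable_slice.
rewrite integral_mkcond; apply: eq_integral => t _.
by rewrite indicE mem_set//= !patchE mul1r; case: ifPn => //= _; rewrite mul0r.
Qed.

Lemma integrable_kernel :
  m1.-integrable D (EFin \o (fun z => \int[m2]_(t in E) (h t * K (z, t)))).
Proof.
apply/(integrable_mkcond _ mD); rewrite -fubini_F_kernel.
exact: integrable_fubini_F.
Qed.

(** Exchanging the integrals moves the average over [z] onto the kernel, where it vanishes for the
    kernels built from [Kker]. *)
Lemma Rintegral_kernel :
  \int[m1]_(z in D) (\int[m2]_(t in E) (h t * K (z, t))) =
  \int[m2]_(t in E) (h t * \int[m1]_(z in D) K (z, t)).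
Proof.
rewrite {1}/Rintegral [in RHS]/Rintegral integral_mkcond -fubini_F_kernel.
congr fine; rewrite (Fubini integrable_f) [RHS]integral_mkcond.
apply: eq_integral => t _; rewrite patchE /f /=.
case: ifPn => [/set_mem Et|/negPf Et]; last first.
  by rewrite integral0_eq// => z _; rewrite patchE Et mul0r mulr0.
have iK : m1.-integrable D (EFin \o (fun z => K (z, t))).
  apply: (@integrable_bounded _ _ _ _ _ mD m1D _ M').
    apply: measurable_funTS; exact: measurable_fun_pair1.
  by move=> z Dz; exact: KM'.
rewrite EFinM /Rintegral fineK; last exact: integrable_fin_num.
rewrite -integralZl// [RHS]integral_mkcond; apply: eq_integral => z _.
rewrite !patchE mem_set// indicE; case: (z \in D); last by rewrite mul0r.
by rewrite mul1r EFinM.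
Qed.

End bounded_kernel.

(** * Affine changes of variable and power integrals *)

Section lebesgue_affine.
Variable R : realType.
Notation mu := (@lebesgue_measure R).

(** The pushforward of Lebesgue measure under the translation has the same values on half-open
    intervals, hence is Lebesgue measure by uniqueness. *)
Lemma ge0_integral_translation (c a b : R) (f : R -> \bar R) :
  measurable_fun setT f -> (forall t, (0 <= f t)%E) ->
  (\int[mu]_(t in `[(a + c)%R, (b + c)%R]) f t = \int[mu]_(t in `[a, b]) f (t + c)%R)%E.
Proof.
move=> mf f0.
pose phi : R -> measurableTypeR R := fun t => t + c.
have mphi : measurable_fun setT phi by exact: measurable_funD.
have preE (x y : bool) : phi @^-1` [set` Interval (BSide x (a + c)) (BSide y (b + c))] =
    [set` Interval (BSide x a) (BSide y b)].
  by apply/seteqP; split=> t /=; case: x; case: y; rewrite /phi /= !in_itv/= ?lerD2r ?ltrD2r.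
transitivity (\int[pushforward mu phi]_(t in `[(a + c)%R, (b + c)%R]) f t)%E; last first.
  by rewrite ge0_integral_pushforward// ?preE//; exact: measurable_funTS.
apply: eq_measure_integral => A mA _.
apply: lebesgue_measure_unique => // _ [[u v] _ <-] /=.
rewrite /pushforward.
rewrite (_ : phi @^-1` _ = `]u - c, v - c]%classic).
  rewrite !lebesgue_measure_itv /= !lte_fin ltrD2r; case: ifP => // _.
  by rewrite -!EFinB; congr EFin; ring.
by apply/seteqP; split=> t /=; rewrite /phi !in_itv/= ltrBlDr lerBrDr.
Qed.

Lemma ge0_integral_reflection (c a b : R) (f : R -> \bar R) :
  measurable_fun setT f -> (forall t, (0 <= f t)%E) ->
  (\int[mu]_(t in `[(c - b)%R, (c - a)%R]) f t = \int[mu]_(t in `[a, b]) f (c - t)%R)%E.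
Proof.
move=> mf f0.
pose phi : R -> measurableTypeR R := fun t => c - t.
have mphi : measurable_fun setT phi by exact: measurable_funB.
have preE : phi @^-1` `[c - b, c - a] = `[a, b]%classic.
  apply/seteqP; split=> t /=; rewrite /phi /= !in_itv/=; lra.
transitivity (\int[pushforward mu phi]_(t in `[(c - b)%R, (c - a)%R]) f t)%E; last first.
  by rewrite ge0_integral_pushforward// ?preE//; exact: measurable_funTS.
apply: eq_measure_integral => A mA _.
apply: lebesgue_measure_unique => // _ [[u v] _ <-] /=.
rewrite /pushforward.
(* Reflection exchanges the open and the closed end, which leaves the length unchanged. *)
rewrite (_ : phi @^-1` _ = `[c - v, c - u[%classic).
  rewrite !lebesgue_measure_itv /= !lte_fin ltrD2l ltrN2; case: ifP => // _.
  by rewrite -!EFinB; congr EFin; ring.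
apply/seteqP; split=> t /=; rewrite /phi !in_itv/=; lra.
Qed.

Lemma integral_powR (q b : R) : 1 <= q -> 0 < b ->
  (\int[mu]_(t in `[0%R, b]) (t `^ q)%:E = (b `^ (q + 1) / (q + 1))%:E)%E.
Proof.
move=> q1 b0; have q0 : 0 < q by rewrite (lt_le_trans ltr01).
(* Powers are differentiated at positive arguments only; at the endpoint 0 one-sided continuity is
   enough for the fundamental theorem. *)
have LR (r : R) : 0 < r -> derivable_oo_LRcontinuous (@powR R ^~ r) 0 b.
  move=> r0; split.
  - by move=> t; rewrite in_itv/= => /andP[t0 _]; apply: derivable_powR; rewrite in_itv/= t0.
  - by rewrite powR0 ?gt_eqF//; exact: powR_cvg0.
  - apply: cvg_at_left_filter.
    have /derivable1_diffP/differentiable_continuous : derivable (@powR R ^~ r) b 1.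
      by apply: derivable_powR; rewrite in_itv/= b0.
    by apply.
rewrite (@continuous_FTC2 _ (@powR R ^~ q) (fun t => t `^ (q + 1) / (q + 1)))//.
- by rewrite powR0 ?gt_eqF ?addr_gt0// mul0r sube0.
- exact: derivable_oo_LRcontinuous_within (LR _ q0).
- have [d0 c0 cb] := LR (q + 1) (addr_gt0 q0 ltr01); split.
  + by move=> t tb; apply: derivableM => //; exact: d0.
  + by apply: cvgMl.
  + by apply: cvgMl.
- move=> t; rewrite in_itv/= => /andP[t0 _].
  rewrite derive1E deriveMr; last by apply: derivable_powR; rewrite in_itv/= t0.
  rewrite -derive1E powR_derive1 ?in_itv/= ?t0// addrK.
  by rewrite mulrA mulVf ?mul1r// gt_eqF// addr_gt0.
Qed.

Lemma integral_powR_sub (q a b : R) : 1 <= q -> a < b ->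
  (\int[mu]_(t in `[a, b]) ((b - t) `^ q)%:E = ((b - a) `^ (q + 1) / (q + 1))%:E)%E.
Proof.
move=> q1 ab; rewrite -integral_powR ?subr_gt0//.
have := @ge0_integral_reflection b a b (fun t => (t `^ q)%:E).
rewrite subrr => ->//; last by move=> t; rewrite lee_fin powR_ge0.
by apply/measurable_EFinP; exact: measurable_powR.
Qed.

End lebesgue_affine.

(** * The discrepancy of the regular grid in one dimension *)

Section grid.
Variable R : realType.
Implicit Types (n m : nat) (t q : R).
Notation mu := (@lebesgue_measure R).

(** The empirical distribution function of either coordinate of a projection regular set, [C] in the
    overview; [sawtooth] below is [D1]. The strict inequality makes it left-continuous, constant on
    the cells [](m - 1)/n, m/n]]. *)
Definition grid_cdf n t : R := (\sum_(k < n) (k%:R / n%:R < t)%R%:R) / n%:R.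

Definition sawtooth n t : R := t - grid_cdf n t.

Lemma measurable_grid_cdf n : measurable_fun setT (grid_cdf n).
Proof.
apply: measurable_funM => //; apply: measurable_sum => k.
rewrite (_ : (fun t => _) = fun t => if k%:R / n%:R < t then 1 else 0).
  by apply: measurable_fun_ifT => //; exact: measurable_fun_ltr.
by apply/funext => t; case: ifP.
Qed.

Lemma measurable_sawtooth n : measurable_fun setT (sawtooth n).
Proof. by apply: measurable_funB => //; exact: measurable_grid_cdf. Qed.

(** The grid points below [t] are those of index [k < m]: the last one counts since [m - 1 < n * t],
    the next does not since [n * t <= m]. Among [t >= 0], the case [m = 0] covers exactly
    [t = 0]. *)
Lemma grid_cdfE n m t : (0 < n)%N -> (m <= n)%N ->
  m%:R - 1 < n%:R * t <= m%:R -> grid_cdf n t = m%:R / n%:R.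
Proof.
move=> n0 mn /andP[mt tm]; congr (_ / _).
rewrite -(subnKC mn) big_split_ord /= [X in _ + X]big1 ?addr0; last first.
  move=> k _; rewrite subnKC// ltr_pdivrMr ?ltr0n// ltNge (mulrC t).
  by rewrite (le_trans tm)//= natrD lerDl.
rewrite (eq_bigr (fun=> 1)) ?sumr_const ?card_ord// => k _.
rewrite subnKC// ltr_pdivrMr ?ltr0n// (mulrC t) (le_lt_trans _ mt)//.
by rewrite lerBrDr natr1 ler_nat.
Qed.

Lemma grid_cellP n t : (0 < n)%N -> 0 <= t <= 1 ->
  exists2 m, (m <= n)%N & m%:R - 1 < n%:R * t <= m%:R.
Proof.
move=> n0 /andP[t0 t1]; have n0' : 0 < n%:R :> R by rewrite ltr0n.
have ex : exists m, n%:R * t <= m%:R by exists n; rewrite ger_pMr.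
(* [m] is the ceiling of [n * t]; minimality gives the strict lower inequality. *)
exists (ex_minn ex); case: ex_minnP => m mt min.
  by apply: min; rewrite ger_pMr.
rewrite mt andbT; case: m mt min => [|m] mt min.
  by rewrite sub0r (lt_le_trans (ltrN10 _))// mulr_ge0// ltW.
rewrite -natr1 addrK ltNge; apply/negP => /min; by rewrite ltnn.
Qed.

Lemma grid_cdf_bounds n t : (0 < n)%N -> 0 <= t <= 1 ->
  [/\ t <= grid_cdf n t, grid_cdf n t < t + n%:R^-1 & 0 <= grid_cdf n t <= 1].
Proof.
move=> n0 t01; have n0' : 0 < n%:R :> R by rewrite ltr0n.
have [m mn mt] := grid_cellP n0 t01; rewrite (grid_cdfE n0 mn mt).
move: mt => /andP[mt tm]; split.
- by rewrite ler_pdivlMr// mulrC.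
- by rewrite ltr_pdivrMr// mulrDl mulVf ?gt_eqF// -ltrBlDr (mulrC t).
- by rewrite divr_ge0//= ler_pdivrMr// mul1r ler_nat.
Qed.

Lemma normr_sawtooth_le1 n t : (0 < n)%N -> 0 <= t <= 1 -> `|sawtooth n t| <= 1.
Proof.
move=> n0 t01; have [_ _ c01] := grid_cdf_bounds n0 t01.
rewrite /sawtooth ler_norml; lra.
Qed.

Lemma grid_cdf_shift n t : (0 < n)%N -> 0 <= t -> t + n%:R^-1 <= 1 ->
  grid_cdf n (t + n%:R^-1) = grid_cdf n t + n%:R^-1.
Proof.
move=> n0 t0 t1; have n0' : 0 < n%:R :> R by rewrite ltr0n.
have ni0 : 0 < n%:R^-1 :> R by rewrite invr_gt0.
have nt : n%:R * (t + n%:R^-1) = n%:R * t + 1 by rewrite mulrDr divff ?gt_eqF.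
have [m mn /andP[mt tm]] : exists2 m, (m <= n)%N & m%:R - 1 < n%:R * t <= m%:R.
  by apply: grid_cellP => //; lra.
have m1n : (m.+1 <= n)%N.
  have : n%:R * (t + n%:R^-1) <= n%:R by rewrite ger_pMr.
  by rewrite nt -(ltr_nat R) => ?; lra.
rewrite (@grid_cdfE n m t) ?mt//.
rewrite (@grid_cdfE n m.+1)// ?nt -?natr1 ?mulrDl ?mul1r//.
by apply/andP; split; lra.
Qed.

(** On the cell []m/n, (m+1)/n]] the absolute value is [(m+1)/n - t], so each of the [n] cells
    contributes [n^-(q+1) / (q+1)]. The induction adds one cell at a time. *)
Lemma integral_sawtooth q n : 1 <= q -> (0 < n)%N ->
  (\int[mu]_(t in `[0%R, 1%R]) (`|sawtooth n t| `^ q)%:E =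
   (n%:R `^ (- q) / (q + 1))%:E)%E.
Proof.
move=> q1 n0; have n0' : 0 < n%:R :> R by rewrite ltr0n.
have nn0 : n%:R != 0 :> R by rewrite gt_eqF.
have q10 : q + 1 != 0 by rewrite gt_eqF// (lt_le_trans ltr01)// (le_trans q1)// lerDl.
have mf D : measurable_fun D (fun t => (`|sawtooth n t| `^ q)%:E).
  apply/measurable_funTS/measurable_EFinP/measurable_normr_powR.
  exact: measurable_sawtooth.
suff H m : (m <= n)%N -> (\int[mu]_(t in `]0%R, (m%:R / n%:R)%R]) (`|sawtooth n t| `^ q)%:E =
   (m%:R / n%:R * (n%:R `^ (- q) / (q + 1)))%:E)%E.
  by rewrite -integral_itv_obnd_cbnd// -[in LHS](divff nn0) H// divff// mul1r.
elim: m => [_|m IH mn].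
  by rewrite !mul0r set_itvoc0 integral_set0.
have mlt : m%:R / n%:R < m.+1%:R / n%:R :> R by rewrite ltr_pM2r ?invr_gt0// ltr_nat.
rewrite (@itv_bndbnd_setU _ _ _ (BRight (m%:R / n%:R))) ?bnd_simp ?divr_ge0 ?(ltW mlt)//.
rewrite ge0_integral_setU//=; first last.
- apply/disj_setPS => t [] /=; rewrite !in_itv/=; lra.
- exact: mf.
rewrite (IH (ltnW mn)).
rewrite (_ : \int[mu]_(x in `](m%:R / n%:R)%R, _]) _ =
  \int[mu]_(x in `](m%:R / n%:R)%R, (m.+1%:R / n%:R)%R]) ((m.+1%:R / n%:R - x) `^ q)%:E)%E; last first.
  apply: eq_integral => t; rewrite inE /= in_itv/= => /andP[t1 t2].
  rewrite /sawtooth (@grid_cdfE n m.+1)//; last first.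
    rewrite -natr1 addrK mulrC; apply/andP; split; first by rewrite -ltr_pdivrMr.
    by rewrite natr1 -ler_pdivlMr.
  by rewrite ler0_norm ?opprB// subr_le0.
rewrite integral_itv_obnd_cbnd; last first.
  apply/measurable_funTS/measurable_EFinP.
  apply: (measurableT_comp (measurable_powR q)); exact: measurable_funB.
rewrite integral_powR_sub// -EFinD; congr EFin.
rewrite -mulrBl -natr1 addrAC subrr add0r mul1r.
have -> : n%:R^-1 `^ (q + 1) = n%:R^-1 * n%:R `^ (- q).
  rewrite powRD; last by rewrite invr_eq0 nn0 implybT.
  rewrite powRr1 ?invr_ge0 ?ler0n// mulrC; congr (_ * _).
  by rewrite -(powR_inv1 (ler0n _ n)) -powRrM mulN1r.
by ring.
Qed.

End grid.

(** * Integration over the unit square *)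

Section averages.
Context {d : measure_display} {T : measurableType d} {R : realType}.
Variables (mu : {measure set T -> \bar R}) (D : set T).
Hypothesis mD : measurable D.

Lemma integrable_mul_bounded (h k : T -> R) (M : R) :
  mu.-integrable D (EFin \o h) -> measurable_fun D k ->
  (forall t, D t -> `|k t| <= M) ->
  mu.-integrable D (EFin \o (fun t => h t * k t)).
Proof.
move=> ih mk kM.
have := @integrableMr _ _ _ mu _ mD k (EFin \o h) mk.
rewrite (_ : (_ \* _)%E = EFin \o (fun t => h t * k t)); last first.
  by apply/funext => t /=; rewrite -EFinM mulrC.
apply => //; exists M; split; first exact: num_real.
by move=> y My t Dt; apply: le_trans (kM _ Dt) (ltW My).
Qed.

Lemma Rintegral_average (n : nat) (h : T -> R) (k : 'I_n -> T -> R) (M : R) :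
  mu.-integrable D (EFin \o h) -> (forall j, measurable_fun D (k j)) ->
  (forall j t, D t -> `|k j t| <= M) ->
  n%:R^-1 * \sum_(j < n) \int[mu]_(t in D) (h t * k j t) =
  \int[mu]_(t in D) (h t * (n%:R^-1 * \sum_(j < n) k j t)).
Proof.
move=> ih mk kM.
have iF j : mu.-integrable D (EFin \o (fun t => h t * k j t)).
  exact: (integrable_mul_bounded ih (mk j) (kM j)).
(* Integrability of the partial sums is carried through the induction because additivity of the
   integral requires it. *)
have [iS ->] : mu.-integrable D (EFin \o (fun t => \sum_(j < n) (h t * k j t))) /\
    \sum_(j < n) \int[mu]_(t in D) (h t * k j t) =
    \int[mu]_(t in D) (\sum_(j < n) (h t * k j t)).
  elim: (index_enum _) => [|j s [IH1 IH2]].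
    under [X in EFin \o X]eq_fun do rewrite big_nil.
    rewrite big_nil; split; first exact: integrable0.
    by under eq_Rintegral do rewrite big_nil; rewrite Rintegral_cst// mul0r.
  have E : (fun t => \sum_(i <- j :: s) (h t * k i t)) =
      (fun t => h t * k j t + \sum_(i <- s) (h t * k i t)).
    by apply/funext => t; rewrite big_cons.
  rewrite E big_cons IH2 RintegralD//; split=> //.
  exact: (integrableD mD (iF j) IH1).
rewrite -RintegralZl//; apply: eq_Rintegral => t _.
by rewrite [RHS]mulrCA -mulr_sumr.
Qed.

End averages.

Section unit_square.
Variable R : realType.
Notation mu := (@lebesgue_measure R).
Notation I01 := (@I01 R).
Notation I01sq := (@I01sq R).
Notation leb1 := (@leb1 R).
Notation leb2 := (@leb2 R).

Lemma measurable_I01 : measurable I01.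
Proof. exact: measurable_itv. Qed.

Lemma measurable_I01sq : measurable I01sq.
Proof. by apply: measurableX; exact: measurable_I01. Qed.

Lemma leb1_I01 : leb1 I01 = 1%E.
Proof. by rewrite /leb1 /I01 lebesgue_measure_itv /= lte_fin ltr01 oppr0 adde0. Qed.

Lemma leb2_I01sq : leb2 I01sq = 1%E.
Proof.
transitivity (leb1 I01 * leb1 I01)%E; last by rewrite leb1_I01 mule1.
by apply: product_measure1E; exact: measurable_I01.
Qed.

Lemma I01P t : I01 t -> 0 <= t <= 1.
Proof. by rewrite /I01 /= in_itv. Qed.

Lemma I01sqP (z : R * R) : I01sq z -> (0 <= z.1 <= 1) /\ (0 <= z.2 <= 1).
Proof. by case=> /I01P ? /I01P. Qed.

Lemma integrable_bounded_I01 (f : R -> R) (M : R) : measurable_fun setT f ->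
  (forall t, I01 t -> `|f t| <= M) -> leb1.-integrable I01 (EFin \o f).
Proof.
move=> mf fM; have mf' := measurable_funTS mf.
exact: (@integrable_bounded _ _ _ leb1 I01 measurable_I01 leb1_I01 f M (mf' I01) fM).
Qed.

Lemma integrable_bounded_I01sq (F : R * R -> R) (M : R) : measurable_fun setT F ->
  (forall z, I01sq z -> `|F z| <= M) -> leb2.-integrable I01sq (EFin \o F).
Proof.
move=> mf fM; have mf' := measurable_funTS mf.
exact: (@integrable_bounded _ _ _ leb2 I01sq measurable_I01sq leb2_I01sq F M (mf' I01sq) fM).
Qed.

Lemma Rintegral_I01sq (F : R * R -> R) (M : R) : measurable_fun setT F ->
  (forall z, I01sq z -> `|F z| <= M) ->
  \int[leb2]_(z in I01sq) F z =
  \int[leb1]_(s in I01) \int[leb1]_(t in I01) F (s, t).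
Proof.
move=> mF FM.
have mI := measurable_I01.
have iF : leb2.-integrable setT ((EFin \o F) \_ I01sq).
  apply: (iffLR (integrable_mkcond (mu := leb2) (EFin \o F) measurable_I01sq)).
  exact: integrable_bounded_I01sq mF FM.
rewrite {1 2}/Rintegral integral_mkcond -(integral12_prod_meas1 iF); congr fine.
rewrite [RHS]integral_mkcond; apply: eq_integral => s _.
rewrite /fubini_F !patchE; case: ifPn => [sI|sI]; last first.
  rewrite integral0_eq// => t _; rewrite patchE.
  by case: ifPn => // /set_mem[/= /mem_set]; rewrite (negPf sI).
rewrite fineK; last first.
  apply: integrable_fin_num => //.
  apply: (@integrable_bounded_I01 _ M); first exact: (measurable_fun_pair2 s mF).
  by move=> t tI; apply: FM; split => //; exact: set_mem sI.
rewrite [RHS]integral_mkcond; apply: eq_integral => t _.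
rewrite !patchE.
have -> : ((s, t) \in I01sq) = (t \in I01).
  apply/idP/idP => /set_mem.
    by case=> _ /= ?; exact: mem_set.
  by move=> ?; apply: mem_set; split => //; exact: set_mem sI.
by case: ifP.
Qed.

Lemma Rintegral_I01sq_mul (f g : R -> R) (M : R) :
  measurable_fun setT f -> measurable_fun setT g ->
  (forall t, I01 t -> `|f t| <= M) -> (forall t, I01 t -> `|g t| <= M) ->
  \int[leb2]_(z in I01sq) (f z.1 * g z.2) =
  \int[leb1]_(t in I01) f t * \int[leb1]_(t in I01) g t.
Proof.
move=> mf mg fM gM.
have M0 : 0 <= M by apply: le_trans (fM 0 _) => //; rewrite /I01 /= in_itv/= lexx ler01.
rewrite (@Rintegral_I01sq _ (M * M)); last 2 first.
- by apply: measurable_funM; [exact: (measurableT_comp mf)|exact: (measurableT_comp mg)].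
- by move=> z [z1 z2]; rewrite normrM ler_pM// ?fM ?gM.
have mI := measurable_I01.
rewrite -RintegralZr//; last first.
  exact: integrable_bounded_I01 mf fM.
apply: eq_Rintegral => s _; rewrite /= RintegralZl//.
exact: integrable_bounded_I01 mg gM.
Qed.

(** In this form, averaging over nodes turns the kernel into [t] minus a point count. *)
Lemma KkerE (x t : R) : Kker x t = t - (x < t)%R%:R.
Proof. by rewrite /Kker; case: ltP => _; rewrite ?subr0. Qed.

Lemma normr_Kker_le1 (x t : R) : I01 t -> `|Kker x t| <= 1.
Proof.
by move=> /I01P t01; rewrite KkerE ler_norml; case: ltP => _ /=; lra.
Qed.

Lemma measurable_Kker {d} {T : measurableType d} (f g : T -> R) :
  measurable_fun setT f -> measurable_fun setT g ->
  measurable_fun setT (fun z => Kker (f z) (g z)).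
Proof.
move=> mf mg; apply: measurable_fun_ifT => //; first exact: measurable_fun_ler.
exact: measurable_funB.
Qed.

(** In the variable [x] the kernel is the constant [t - 1] plus the indicator of [[t, 1]], whose
    measure is [1 - t]. *)
Lemma Rintegral_Kker t : I01 t -> \int[leb1]_(x in I01) Kker x t = 0.
Proof.
move=> tI; have /andP[t0 t1] := I01P tI; have mI := measurable_I01.
have mi : measurable (`[t, 1%R] : set R) by exact: measurable_itv.
transitivity (\int[leb1]_(x in I01) ((t - 1) + \1_(`[t, 1%R] : set R) x)).
  apply: eq_Rintegral.
  move=> x /set_mem/I01P/andP[x0 x1]; rewrite /Kker indicE.
  by rewrite mem_setE in_itv/= x1 andbT; case: leP => _; rewrite ?addr0 ?subrK.
have iind : leb1.-integrable I01 (EFin \o (\1_`[t, 1%R] : R -> R)).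
  apply: (@integrable_bounded_I01 _ 1); first exact: measurable_indic.
  by move=> x _; rewrite indicE ger0_norm ?ler0n// lern1 leq_b1.
rewrite RintegralD//; last first.
  by apply: (@integrable_bounded_I01 _ `|t - 1|) => //; exact: measurable_cst.
have -> : \int[leb1]_(x in I01) (t - 1) = t - 1.
  rewrite Rintegral_cst// -[RHS]mulr1; congr (_ * _).
  exact: (congr1 fine leb1_I01).
have -> : \int[leb1]_(x in I01) (\1_(`[t, 1%R] : set R) x) = 1 - t.
  rewrite /Rintegral integral_indic//.
  rewrite (_ : _ `&` _ = `[t, 1%R]%classic); last first.
    by apply: setIidl => x; rewrite /I01 /= !in_itv/= => /andP[tx ->]; rewrite (le_trans t0).
  transitivity (fine (lebesgue_measure (`[t, 1%R]%classic : set R))) => //.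
  rewrite lebesgue_measure_itv /= lte_fin.
  case: ltP => t1' //=; apply/eqP; by rewrite eq_sym subr_eq0 eq_le t1 t1'.
by rewrite addrC addrA subrK subrr.
Qed.

End unit_square.

(** * The error functional of the QMC rule *)

Section QMC_error.
Variable R : realType.
Notation I01 := (@I01 R).
Notation I01sq := (@I01sq R).
Notation leb1 := (@leb1 R).
Notation leb2 := (@leb2 R).

Lemma sigma_finite_leb2 : sigma_finite setT leb2.
Proof.
pose F (n : nat) : set R := `[- n%:R, n%:R]%classic.
exists (fun n => F n `*` F n).
  apply/esym/seteqP; split=> // -[s t] _.
  pose m := (Num.trunc `|s| + Num.trunc `|t|).+1.
  exists m => //; split; rewrite /F /= in_itv/= -ler_norml ltW//.
    apply: lt_le_trans (truncnS_gt _) _; rewrite ler_nat ltnS leq_addr //.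
  apply: lt_le_trans (truncnS_gt _) _; rewrite ler_nat ltnS leq_addl //.
move=> n; have mF : measurable (F n) by exact: measurable_itv.
split; first exact: measurableX.
have Foo : (@lebesgue_measure R (F n) < +oo)%E.
  by rewrite /F lebesgue_measure_itv; case: ifP => _ //=; rewrite -EFinD ltry.
rewrite /leb2 product_measure1E// lte_mul_pinfty ?measure_ge0//.
by rewrite ge0_fin_numE// measure_ge0.
Qed.

(* The canonical sigma-finite structure of a product measure is not found on
   [leb1 \x leb1], being shadowed by the one for subprobabilities. *)
HB.instance Definition _ := Measure.copy leb2 (@lebesgue_measure R \x @lebesgue_measure R)%E.
HB.instance Definition _ := @Measure_isSigmaFinite.Build _ _ _ leb2 sigma_finite_leb2.
(** The hypothesis only equates sets, so multiplicities need an argument: choosing a node with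
    coordinate [k/n] for each [k] gives an injection of ['I_n] into itself, hence a permutation
    along which the sum is reindexed. *)
Lemma grid_cdf_range n (x : 'I_n -> R) t : (0 < n)%N ->
  range x = [set (k%:R / n%:R : R) | k in `I_n] ->
  (\sum_(j < n) (x j < t)%R%:R) / n%:R = grid_cdf n t.
Proof.
move=> n0 xE; congr (_ / _).
have /choice[tau tauE] : forall k : 'I_n, exists j, x j = k%:R / n%:R.
  move=> k; have : range x (k%:R / n%:R) by rewrite xE; exists k => //=.
  by case=> j _ <-; exists j.
have tau_inj : injective tau.
  move=> k l /(congr1 x); rewrite !tauE => /(mulIf _) kl; apply/val_inj/eqP.
  by rewrite -(eqr_nat R) kl// invr_eq0 pnatr_eq0 -lt0n.
rewrite (reindex tau) /=; last exact: onW_bij (injF_bij tau_inj).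
by apply: eq_bigr => k _; rewrite tauE.
Qed.

Lemma average_Kker n (x : 'I_n -> R) t : (0 < n)%N ->
  range x = [set (k%:R / n%:R : R) | k in `I_n] ->
  n%:R^-1 * (\sum_(j < n) Kker (x j) t) = sawtooth n t.
Proof.
move=> n0 xE; under eq_bigr do rewrite KkerE.
rewrite big_split /= sumrN sumr_const card_ord mulrDr mulrN -[t *+ n]mulr_natl mulrA.
rewrite mulVf ?pnatr_eq0 -?lt0n// mul1r; congr (_ - _).
by rewrite mulrC grid_cdf_range.
Qed.

(** [D12] of the overview; up to sign it represents the error functional on the component with both
    variables. *)
Definition anova_kernel n (x y : 'I_n -> R) (t : R * R) : R :=
  discr x y t + (t.1 * sawtooth n t.2 + t.2 * sawtooth n t.1).

(** The average expands into the joint count over [n] plus [t1 * t2 - t1 * C t2 - t2 * C t1]. Taking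
    [- t1 * t2] into [Delta] leaves [2 * t1 * t2], one copy for each sawtooth term. *)
Lemma average_Kker2 n (x y : 'I_n -> R) t : (0 < n)%N -> proj_regular x y ->
  n%:R^-1 * (\sum_(j < n) Kker (x j) t.1 * Kker (y j) t.2) = anova_kernel x y t.
Proof.
move=> n0 [xE yE]; have nn0 : n%:R != 0 :> R by rewrite pnatr_eq0 -lt0n.
rewrite /anova_kernel /discr /sawtooth -(grid_cdf_range t.1 n0 xE) -(grid_cdf_range t.2 n0 yE).
rewrite (eq_bigr (fun j => (t.1 * t.2 - t.1 * (y j < t.2)%R%:R - t.2 * (x j < t.1)%R%:R)
  + ((x j < t.1) && (y j < t.2))%:R)); last first.
  move=> j _; rewrite !KkerE -mulnb natrM; ring.
rewrite big_split /= !sumrB -!mulr_sumr sumr_const card_ord -[t.2 *+ n]mulr_natl.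
by field.
Qed.

Lemma measurable_discr n (x y : 'I_n -> R) : measurable_fun setT (discr x y).
Proof.
apply: measurable_funB; last exact: measurable_funM.
apply: measurable_funM => //; apply: measurable_sum => j.
rewrite (_ : (fun t => _) = fun t : R * R => if (x j < t.1) && (y j < t.2) then 1 else 0).
  apply: measurable_fun_ifT => //; apply: measurable_and; exact: measurable_fun_ltr.
by apply/funext => t; case: ifP.
Qed.

Lemma measurable_anova_kernel n (x y : 'I_n -> R) :
  measurable_fun setT (anova_kernel x y).
Proof.
apply: measurable_funD; first exact: measurable_discr.
apply: measurable_funD; apply: measurable_funM => //.
  exact: (measurableT_comp (@measurable_sawtooth R n)).
exact: (measurableT_comp (@measurable_sawtooth R n)).
Qed.

Lemma normr_anova_kernel_le1 n (x y : 'I_n -> R) t : (0 < n)%N ->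
  proj_regular x y -> I01sq t -> `|anova_kernel x y t| <= 1.
Proof.
move=> n0 xy [t1 t2]; have n0' : 0 < n%:R :> R by rewrite ltr0n.
rewrite -(average_Kker2 _ n0 xy) normrM gtr0_norm ?invr_gt0// mulrC ler_pdivrMr// mul1r.
apply: le_trans (ler_norm_sum _ _ _) _.
rewrite -[n in leRHS]card_ord -sumr_const; apply: ler_sum => j _.
by rewrite normrM mulr_ile1// normr_Kker_le1.
Qed.

Section formula.
Variables (n : nat) (x y : 'I_n -> R) (c : R) (h1 h2 : R -> R) (h12 : R * R -> R).
Hypotheses (n0 : (0 < n)%N) (xy : proj_regular x y).
Hypotheses (i1 : leb1.-integrable I01 (EFin \o h1))
  (i2 : leb1.-integrable I01 (EFin \o h2))
  (i12 : leb2.-integrable I01sq (EFin \o h12)).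

(** [pr] stands for either coordinate projection, so that both one-variable components are treated
    at once. *)
Let Rintegral_comp (h : R -> R) (pr : R * R -> R) :
  measurable_fun setT pr ->
  (forall t, I01 t -> \int[leb2]_(z in I01sq) Kker (pr z) t = 0) ->
  leb1.-integrable I01 (EFin \o h) ->
  leb2.-integrable I01sq (EFin \o (fun z => comp1 h (pr z))) /\
  \int[leb2]_(z in I01sq) comp1 h (pr z) = 0.
Proof.
move=> mpr pr0 ih.
pose K (zt : (R * R) * R) := Kker (pr zt.1) zt.2.
have mK : measurable_fun setT K.
  by apply: measurable_Kker => //; exact: (measurableT_comp mpr).
have K1 z t : I01sq z -> I01 t -> `|K (z, t)| <= 1.
  by move=> _ It; exact: normr_Kker_le1.
split.
  exact: (@integrable_kernel _ _ _ _ _ leb2 leb1 _ _ _ _ _ (@measurable_I01sq R) (@measurable_I01 R) (@leb2_I01sq R) ih mK K1).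
have := @Rintegral_kernel _ _ _ _ _ leb2 leb1 _ _ _ _ _ (@measurable_I01sq R) (@measurable_I01 R) (@leb2_I01sq R) ih mK K1.
move=> ->; rewrite /K /=.
transitivity (\int[leb1]_(t in I01) (0 : R)).
  by apply: eq_Rintegral => t /set_mem It; rewrite pr0// mulr0.
by rewrite Rintegral_cst ?mul0r//; exact: measurable_I01.
Qed.

Lemma Rintegral_comp1_fst (h : R -> R) : leb1.-integrable I01 (EFin \o h) ->
  leb2.-integrable I01sq (EFin \o (fun z => comp1 h z.1)) /\
  \int[leb2]_(z in I01sq) comp1 h z.1 = 0.
Proof.
apply: Rintegral_comp => // t It.
have := @Rintegral_I01sq_mul R (fun s => Kker s t) (cst 1) 1.
rewrite Rintegral_Kker// mul0r => <-//.
- by apply: eq_Rintegral => z _; rewrite mulr1.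
- exact: measurable_Kker.
- by move=> s _; exact: normr_Kker_le1.
- by move=> s _; rewrite normr1.
Qed.

Lemma Rintegral_comp1_snd (h : R -> R) : leb1.-integrable I01 (EFin \o h) ->
  leb2.-integrable I01sq (EFin \o (fun z => comp1 h z.2)) /\
  \int[leb2]_(z in I01sq) comp1 h z.2 = 0.
Proof.
apply: Rintegral_comp => // t It.
have := @Rintegral_I01sq_mul R (cst 1) (fun s => Kker s t) 1.
rewrite Rintegral_Kker// mulr0 => <-//.
- by apply: eq_Rintegral => z _; rewrite mul1r.
- exact: measurable_Kker.
- by move=> s _; rewrite normr1.
- by move=> s _; exact: normr_Kker_le1.
Qed.

Lemma Rintegral_comp12 (h : R * R -> R) : leb2.-integrable I01sq (EFin \o h) ->
  leb2.-integrable I01sq (EFin \o (fun z => comp12 h z.1 z.2)) /\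
  \int[leb2]_(z in I01sq) comp12 h z.1 z.2 = 0.
Proof.
move=> ih.
pose K (zt : (R * R) * (R * R)) := Kker zt.1.1 zt.2.1 * Kker zt.1.2 zt.2.2.
have mK : measurable_fun setT K.
  by apply: measurable_funM; apply: measurable_Kker => //; apply: measurableT_comp.
have K1 z t : I01sq z -> I01sq t -> `|K (z, t)| <= 1.
  by move=> _ [t1 t2]; rewrite normrM mulr_ile1// normr_Kker_le1.
have E z : comp12 h z.1 z.2 = \int[leb2]_(t in I01sq) (h t * K (z, t)).
  by apply: eq_Rintegral => t _; rewrite mulrA.
rewrite (_ : (fun z => comp12 h z.1 z.2) = fun z => \int[leb2]_(t in I01sq) (h t * K (z, t))); last first.
  by apply/funext => z; rewrite E.
split.
  exact: (@integrable_kernel _ _ _ _ _ leb2 leb2 _ _ _ _ _ (@measurable_I01sq R) (@measurable_I01sq R) (@leb2_I01sq R) ih mK K1).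
have := @Rintegral_kernel _ _ _ _ _ leb2 leb2 _ _ _ _ _ (@measurable_I01sq R) (@measurable_I01sq R) (@leb2_I01sq R) ih mK K1.
move=> ->.
transitivity (\int[leb2]_(t in I01sq) (0 : R)).
  apply: eq_Rintegral => t /set_mem[t1 t2].
  have := @Rintegral_I01sq_mul R (fun s => Kker s t.1) (fun s => Kker s t.2) 1.
  rewrite Rintegral_Kker// mul0r /K /= => ->; rewrite ?mulr0//.
  - exact: measurable_Kker.
  - exact: measurable_Kker.
  - by move=> s _; exact: normr_Kker_le1.
  - by move=> s _; exact: normr_Kker_le1.
by rewrite Rintegral_cst ?mul0r//; exact: measurable_I01sq.
Qed.

Lemma Rintegral_Ffun :
  \int[leb2]_(z in I01sq) Ffun c h1 h2 h12 z.1 z.2 = c.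
Proof.
have mD : measurable (I01sq : set (measurableTypeR R * measurableTypeR R)) := @measurable_I01sq R.
have [j1 e1] := Rintegral_comp1_fst i1.
have [j2 e2] := Rintegral_comp1_snd i2.
have [j3 e3] := Rintegral_comp12 i12.
have jc : leb2.-integrable I01sq (EFin \o (cst c : R * R -> R)).
  by apply: (@integrable_bounded_I01sq _ _ `|c|) => //; exact: measurable_cst.
have jc1 := integrableD mD jc j1.
have jc2 := integrableD mD jc1 j2.
rewrite /Ffun RintegralD// RintegralD// RintegralD// e1 e2 e3 !addr0.
rewrite Rintegral_cst// -[RHS]mulr1; congr (_ * _).
exact: (congr1 fine (@leb2_I01sq R)).
Qed.

(** The constant [c] cancels, being integrated exactly by the rule. What remains is minus the rule
    applied to the other components, with the average over the nodes moved under the integral onto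
    the kernel. *)
Lemma QMC_error_formula :
  \int[leb2]_(z in I01sq) Ffun c h1 h2 h12 z.1 z.2 - QMC2 x y (Ffun c h1 h2 h12) =
  - (\int[leb1]_(t in I01) (h1 t * sawtooth n t) +
     \int[leb1]_(t in I01) (h2 t * sawtooth n t) +
     \int[leb2]_(t in I01sq) (h12 t * anova_kernel x y t)).
Proof.
have [xE yE] := xy.
rewrite Rintegral_Ffun /QMC2 /Ffun.
have nn0 : n%:R != 0 :> R by rewrite pnatr_eq0 -lt0n.
have mI := @measurable_I01 R.
have a1 (h : R -> R) (u : 'I_n -> R) : range u = [set (k%:R / n%:R : R) | k in `I_n] ->
    leb1.-integrable I01 (EFin \o h) ->
    n%:R^-1 * (\sum_(j < n) comp1 h (u j)) = \int[leb1]_(t in I01) (h t * sawtooth n t).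
  move=> uE ih.
  have := @Rintegral_average _ _ _ leb1 _ mI n h (fun j t => Kker (u j) t) 1 ih.
  move=> ->.
  - by apply: eq_Rintegral => t _; rewrite average_Kker.
  - by move=> j; apply: measurable_funTS; exact: measurable_Kker.
  - by move=> j t; exact: normr_Kker_le1.
have a2 : n%:R^-1 * (\sum_(j < n) comp12 h12 (x j) (y j)) =
    \int[leb2]_(t in I01sq) (h12 t * anova_kernel x y t).
  have := @Rintegral_average _ _ _ leb2 _ (@measurable_I01sq R) n h12
    (fun j t => Kker (x j) t.1 * Kker (y j) t.2) 1 i12.
  rewrite (eq_bigr (fun j => comp12 h12 (x j) (y j))); last first.
    by move=> j _; apply: eq_Rintegral => t _; rewrite mulrA.
  move=> ->.
  - by apply: eq_Rintegral => t _; rewrite average_Kker2.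
  - by move=> j; apply: measurable_funTS; apply: measurable_funM; exact: measurable_Kker.
  - by move=> j t [t1 t2]; rewrite normrM mulr_ile1// normr_Kker_le1.
rewrite !big_split /= !mulrDr a1// a1// a2 sumr_const card_ord -[c *+ n]mulr_natl mulrA mulVf// mul1r.
by ring.
Qed.

End formula.
End QMC_error.

(** * Integrals of powers of the kernel *)

Section powR_convexity.
Variable R : realType.
Implicit Types (a b c q : R).

Lemma powR_convex q (l a b : R) : 1 <= q -> 0 <= l <= 1 -> 0 <= a -> 0 <= b ->
  (l * a + (1 - l) * b) `^ q <= l * a `^ q + (1 - l) * b `^ q.
Proof.
move=> q1 /andP[l0 l1] a0 b0.
by apply: (convex_powR q1 (Itv01 l0 l1)); rewrite inE/= in_itv/= ?a0 ?b0.
Qed.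

(** Jensen's inequality with three equal weights, from two uses of two-point convexity: [v] is the
    mean of the three absolute values, formed as one third of [|c|] plus two thirds of the mean [u]
    of the others. The constant is [3 ^ q / 3]. *)
Lemma powR_normD3 q a b c : 1 <= q ->
  `|a + b + c| `^ q <= 3 `^ (q - 1) * (`|a| `^ q + `|b| `^ q + `|c| `^ q).
Proof.
move=> q1; have q0 : 0 <= q by rewrite (le_trans _ q1).
pose u := 2^-1 * `|a| + (1 - 2^-1) * `|b|.
pose v := 3^-1 * `|c| + (1 - 3^-1) * u.
have u0 : 0 <= u by rewrite addr_ge0// mulr_ge0//; lra.
have v0 : 0 <= v by rewrite addr_ge0// mulr_ge0//; lra.
apply: (@le_trans _ _ ((3 * v) `^ q)).
  rewrite ge0_ler_powR ?nnegrE ?mulr_ge0//.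
  apply: le_trans (ler_normD _ _) _; have := ler_normD a b; rewrite /v /u; lra.
rewrite powRM// (_ : 3 `^ (q - 1) = 3 `^ q / 3); last first.
  by rewrite powRD ?powRN ?powRr1//; apply/implyP.
rewrite -mulrA.
apply: ler_wpM2l; first exact: powR_ge0.
have h3 : 0 <= (3^-1 : R) <= 1 by rewrite invr_ge0 ler0n invf_le1// ler1n.
have h2 : 0 <= (2^-1 : R) <= 1 by rewrite invr_ge0 ler0n invf_le1// ler1n.
apply: le_trans (powR_convex q1 h3 (normr_ge0 c) u0) _.
have := powR_convex q1 h2 (normr_ge0 a) (normr_ge0 b); rewrite -/u; lra.
Qed.

(** At least one of [|a|], [|b|] reaches [k / 2]. Bounding the sum of both powers avoids deciding
    which one and can be integrated. *)
Lemma powR_half_gap q (k a b : R) : 0 <= q -> 0 <= k -> k <= `|a - b| ->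
  (k / 2) `^ q <= `|a| `^ q + `|b| `^ q.
Proof.
move=> q0 k0 kab; have := ler_normB a b => nab.
have [ka|ka] := leP (k / 2) `|a|.
  rewrite -[leLHS]addr0 lerD ?powR_ge0//.
  by rewrite ge0_ler_powR// nnegrE divr_ge0.
rewrite -[leLHS]add0r lerD ?powR_ge0//.
rewrite ge0_ler_powR// ?nnegrE ?divr_ge0//; lra.
Qed.

End powR_convexity.

Section intpow_sum.
Context {d : measure_display} {T : measurableType d} {R : realType}.
Variables (mu : {measure set T -> \bar R}) (D : set T).
Hypotheses (mD : measurable D) (muD : mu D = 1%E).

Lemma intpowD3 (q M : R) (f g h : T -> R) : 1 <= q ->
  measurable_fun D f -> measurable_fun D g -> measurable_fun D h ->
  (forall t, D t -> `|f t| <= M) -> (forall t, D t -> `|g t| <= M) ->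
  (forall t, D t -> `|h t| <= M) ->
  intpow mu D q (fun t => f t + g t + h t) <=
  3 `^ (q - 1) * (intpow mu D q f + intpow mu D q g + intpow mu D q h).
Proof.
move=> q1 mf mg mh fM gM hM; have q0 : 0 <= q by rewrite (le_trans _ q1).
have If := integrable_normr_powR mD muD q0 mf fM.
have Ig := integrable_normr_powR mD muD q0 mg gM.
have Ih := integrable_normr_powR mD muD q0 mh hM.
have Ifg := integrableD mD If Ig.
have Ifgh := integrableD mD Ifg Ih.
rewrite /intpow -RintegralD// -RintegralD// -RintegralZl//.
apply: le_Rintegral => //.
- apply: (integrable_normr_powR mD muD q0 (M := M + M + M)).
    by apply: measurable_funD => //; exact: measurable_funD.
  move=> t Dt; apply: le_trans (ler_normD _ _) _; rewrite lerD ?hM//.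
  by apply: le_trans (ler_normD _ _) _; rewrite lerD ?fM ?gM.
- exact: (integrableZl mD (3 `^ (q - 1)) Ifgh).
- by move=> t Dt; exact: powR_normD3.
Qed.

Lemma intpowN (q : R) (f : T -> R) : intpow mu D q (fun t => - f t) = intpow mu D q f.
Proof. by apply: eq_Rintegral => t _; rewrite normrN. Qed.

End intpow_sum.

Section discrepancy_bounds.
Variable R : realType.
Notation I01 := (@I01 R).
Notation I01sq := (@I01sq R).
Notation leb1 := (@leb1 R).
Notation leb2 := (@leb2 R).

Lemma intpow_sawtooth (q : R) n : 1 <= q -> (0 < n)%N ->
  intpow leb1 I01 q (sawtooth n) = n%:R `^ (- q) / (q + 1).
Proof.
move=> q1 n0; exact: (congr1 fine (integral_sawtooth q1 n0)).
Qed.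

Lemma intpow_id (q : R) : 1 <= q -> intpow leb1 I01 q id = (q + 1)^-1.
Proof.
move=> q1; have := congr1 fine (integral_powR q1 (@ltr01 R)).
rewrite /= powR1 div1r => <-; apply: eq_Rintegral => t /set_mem/I01P/andP[t0 _].
by rewrite /= ger0_norm.
Qed.

Lemma intpow_mul (q : R) (f g : R -> R) : 0 <= q ->
  measurable_fun setT f -> measurable_fun setT g ->
  (forall t, I01 t -> `|f t| <= 1) -> (forall t, I01 t -> `|g t| <= 1) ->
  intpow leb2 I01sq q (fun z => f z.1 * g z.2) = intpow leb1 I01 q f * intpow leb1 I01 q g.
Proof.
move=> q0 mf mg f1 g1.
have mq (h : R -> R) : measurable_fun setT h -> measurable_fun setT (fun t => `|h t| `^ q).
  move=> mh; exact: measurable_normr_powR.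
have q1 (h : R -> R) : (forall t, I01 t -> `|h t| <= 1) -> forall t, I01 t -> `| `|h t| `^ q| <= 1.
  move=> h1 t It; rewrite ger0_norm ?powR_ge0//.
  apply: (@le_trans _ _ (1 `^ q)); last by rewrite powR1.
  by rewrite ge0_ler_powR ?nnegrE// h1.
have := Rintegral_I01sq_mul (mq _ mf) (mq _ mg) (q1 _ f1) (q1 _ g1).
by move=> <-; apply: eq_Rintegral => z _; rewrite normrM powRM.
Qed.

(** Each cross term factors over the two axes, into [1/(q+1)] from the identity and the sawtooth
    integral; the two terms together produce [2 / (q+1)^2] in the theorem. *)
Lemma intpow_mul_sawtooth (q : R) n : 1 <= q -> (0 < n)%N ->
  intpow leb2 I01sq q (fun z => z.1 * sawtooth n z.2) = n%:R `^ (- q) / (q + 1) ^+ 2 /\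
  intpow leb2 I01sq q (fun z => z.2 * sawtooth n z.1) = n%:R `^ (- q) / (q + 1) ^+ 2.
Proof.
move=> q1 n0; have q0 : 0 <= q by rewrite (le_trans _ q1).
have id1 (t : R) : I01 t -> `|id t| <= 1.
  by move=> /I01P/andP[t0 t1]; rewrite /= ger0_norm.
have st1 (t : R) : I01 t -> `|sawtooth n t| <= 1.
  by move=> /I01P; exact: normr_sawtooth_le1.
have ms := @measurable_sawtooth R n.
have e : (q + 1)^-1 * (n%:R `^ (- q) / (q + 1)) = n%:R `^ (- q) / (q + 1) ^+ 2.
  by rewrite expr2 invfM mulrCA mulrA.
split.
  have := intpow_mul q0 (@measurable_id _ R setT) ms id1 st1.
  by rewrite intpow_id// intpow_sawtooth// e.
have := intpow_mul q0 ms (@measurable_id _ R setT) st1 id1.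
rewrite intpow_id// intpow_sawtooth// mulrC e => <-.
by apply: eq_Rintegral => z _; rewrite mulrC.
Qed.

End discrepancy_bounds.

(** * Comparison of [Delta] with [D12], and the increments of [D12] over one grid step *)

Section anova_kernel_bounds.
Variables (R : realType) (n : nat) (x y : 'I_n -> R).
Hypotheses (n0 : (0 < n)%N) (xy : proj_regular x y).
Notation I01 := (@I01 R).
Notation I01sq := (@I01sq R).
Notation leb1 := (@leb1 R).
Notation leb2 := (@leb2 R).

Let n0' : 0 < n%:R :> R. Proof. by rewrite ltr0n. Qed.

Let mI : measurable (I01sq : set (measurableTypeR R * measurableTypeR R)).
Proof. exact: measurable_I01sq. Qed.

Let f1 (z : R * R) := z.1 * sawtooth n z.2.
Let f2 (z : R * R) := z.2 * sawtooth n z.1.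

Let mf1 : measurable_fun setT f1.
Proof.
apply: measurable_funM => //.
exact: (measurableT_comp (@measurable_sawtooth R n)).
Qed.

Let mf2 : measurable_fun setT f2.
Proof.
apply: measurable_funM => //.
exact: (measurableT_comp (@measurable_sawtooth R n)).
Qed.

Let f1_le z : I01sq z -> `|f1 z| <= 1.
Proof.
move=> /I01sqP[/andP[? ?] z2]; rewrite normrM mulr_ile1//.
  by rewrite ger0_norm.
exact: normr_sawtooth_le1.
Qed.

Let f2_le z : I01sq z -> `|f2 z| <= 1.
Proof.
move=> /I01sqP[z1 /andP[? ?]]; rewrite normrM mulr_ile1//.
  by rewrite ger0_norm.
exact: normr_sawtooth_le1.
Qed.

Let normr_discr_le z : I01sq z -> `|discr x y z| <= 3.
Proof.
move=> Iz; have := f1_le Iz; have := f2_le Iz.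
have := normr_anova_kernel_le1 n0 xy Iz.
rewrite /anova_kernel -/(f1 z) -/(f2 z) !ler_norml; lra.
Qed.

Lemma intpow_anova_kernel_le (q : R) : 1 <= q ->
  intpow leb2 I01sq q (anova_kernel x y) <=
  3 `^ (q - 1) * (intpow leb2 I01sq q (discr x y) + 2 * (n%:R `^ (- q) / (q + 1) ^+ 2)).
Proof.
move=> q1; have [e1 e2] := intpow_mul_sawtooth q1 n0.
have := @intpowD3 _ _ _ leb2 I01sq mI (@leb2_I01sq R) q 3 (discr x y) f1 f2 q1
  (measurable_funTS (measurable_discr x y)) (measurable_funTS mf1) (measurable_funTS mf2)
  normr_discr_le.
rewrite -addrA -/f1 -/f2 => H.
have -> : 2 * (n%:R `^ (- q) / (q + 1) ^+ 2) =
  intpow leb2 I01sq q f1 + intpow leb2 I01sq q f2 by rewrite e1 e2 -mulr2n mulr_natl.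
rewrite [leLHS](_ : _ = intpow leb2 I01sq q (fun t => discr x y t + f1 t + f2 t)).
  by apply: H => z Iz; rewrite (@le_trans _ _ 1) ?ler1n// ?f1_le ?f2_le.
by apply: eq_Rintegral => z _; rewrite /anova_kernel addrA.
Qed.

(** [Delta] is [D12] minus the two cross terms, so the convexity argument works in this direction
    too, with the same constants. *)
Lemma intpow_discr_le (q : R) : 1 <= q ->
  intpow leb2 I01sq q (discr x y) <=
  3 `^ (q - 1) * (intpow leb2 I01sq q (anova_kernel x y) + 2 * (n%:R `^ (- q) / (q + 1) ^+ 2)).
Proof.
move=> q1; have [e1 e2] := intpow_mul_sawtooth q1 n0.
have mN (f : R * R -> R) : measurable_fun setT f -> measurable_fun setT (fun z => - f z).
  by move=> mf; exact: measurableT_comp.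
have := @intpowD3 _ _ _ leb2 I01sq mI (@leb2_I01sq R) q 1 (anova_kernel x y)
  (fun z => - f1 z) (fun z => - f2 z) q1
  (measurable_funTS (measurable_anova_kernel x y)) (measurable_funTS (mN _ mf1))
  (measurable_funTS (mN _ mf2)) (fun z => @normr_anova_kernel_le1 _ _ x y z n0 xy).
rewrite !intpowN -addrA => H.
have -> : 2 * (n%:R `^ (- q) / (q + 1) ^+ 2) =
  intpow leb2 I01sq q f1 + intpow leb2 I01sq q f2 by rewrite e1 e2 -mulr2n mulr_natl.
rewrite [leLHS](_ : _ = intpow leb2 I01sq q (fun t => anova_kernel x y t + - f1 t + - f2 t)).
  by apply: H => z Iz; rewrite normrN ?f1_le ?f2_le.
by apply: eq_Rintegral => z _; congr (`| _ | `^ _); rewrite /anova_kernel -/(f1 z) -/(f2 z); ring.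
Qed.

Lemma grid_cdf_quarter (s : R) : (1 < n)%N -> 4^-1 <= s <= 2^-1 ->
  4^-1 <= grid_cdf n s <= 3 / 4.
Proof.
move=> n1 /andP[s4 s2]; have s01 : 0 <= s <= 1 by apply/andP; split; lra.
have [sc _ _] := grid_cdf_bounds n0 s01; rewrite (le_trans s4 sc)/=.
have [m mn ms] := grid_cellP n0 s01; rewrite (grid_cdfE n0 mn ms).
rewrite ler_pdivrMr// mulrAC ler_pdivlMr// -!natrM ler_nat.
(* From [m - 1 < n/2] and integrality, [2m <= n + 1]; hence [4m <= 2n + 2 <= 3n] as [n >= 2]. *)
suff : (2 * m < n + 2)%N by lia.
move: ms => /andP[ms _]; rewrite -(ltr_nat R) natrM natrD.
have : n%:R * s <= n%:R * 2^-1 by rewrite ler_pM2l.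
lra.
Qed.

Lemma anova_kernel_gap (s t : R) : (1 < n)%N -> 4^-1 <= s <= 2^-1 ->
  0 <= t <= 2^-1 ->
  (4 * n%:R)^-1 <= `|anova_kernel x y (s, t + n%:R^-1) - anova_kernel x y (s, t)|.
Proof.
move=> n1 s42 /andP[t0 t2]; have [xE yE] := xy.
have ni0 : 0 < n%:R^-1 :> R by rewrite invr_gt0.
have t1 : t + n%:R^-1 <= 1.
  have : n%:R^-1 <= 2^-1 :> R by rewrite lef_pV2 ?posrE// ler_nat.
  lra.
(* The nodes that enter the joint count when [t] moves to [t + 1/n]; their number is [d] of the
   overview. *)
pose b j := ((x j < s) && ((t <= y j) && (y j < t + n%:R^-1)) : nat).
have Nb : \sum_(j < n) ((x j < s) && (y j < t + n%:R^-1))%:R =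
    \sum_(j < n) ((x j < s) && (y j < t))%:R + (\sum_(j < n) b j)%:R :> R.
  rewrite natr_sum -big_split /=; apply: eq_bigr => j _; rewrite /b.
  case: (x j < s) => /=; last by rewrite addr0.
  case: (ltP (y j) t) => ytj /=; last by rewrite add0r.
  by rewrite addr0 (lt_trans ytj)// ltrDl.
(* By [grid_cdf_shift] the window [[t, t + 1/n[] contains exactly one second coordinate, so at most
   one node enters. *)
have b1 : (\sum_(j < n) b j <= 1)%N.
  rewrite -(ler_nat R).
  have := grid_cdf_shift n0 t0 t1.
  rewrite -(grid_cdf_range (t + _) n0 yE) -(grid_cdf_range t n0 yE).
  move/(congr1 ( *%R^~ n%:R)); rewrite /= mulrDl mulVf ?gt_eqF// !divfK ?gt_eqF// => E.
  rewrite -(lerD2l (\sum_(j < n) (y j < t)%R%:R)) -E natr_sum -big_split /=.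
  apply: ler_sum => j _; rewrite /b.
  case: (ltP (y j) t) => ytj /=; first by rewrite andbF addr0 (lt_trans ytj)// ltrDl.
  by rewrite add0r; case: (x j < s).
have -> : anova_kernel x y (s, t + n%:R^-1) - anova_kernel x y (s, t) =
    ((\sum_(j < n) b j)%:R - grid_cdf n s) / n%:R.
  rewrite /anova_kernel /discr /sawtooth /= Nb grid_cdf_shift//.
  by field; rewrite gt_eqF.
rewrite normrM (gtr0_norm ni0) invfM ler_pM2r//.
(* Both 0 and 1 are at distance at least [1/4] from the interval [[1/4, 3/4]]. *)
have /andP[c1 c2] := grid_cdf_quarter n1 s42.
case: (\sum_(j < n) b j)%N b1 => [|[|//]] _.
  by rewrite sub0r normrN ger0_norm//; lra.
by rewrite ger0_norm; lra.
Qed.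

End anova_kernel_bounds.

(** * The norm of [D12] is at least of order [1/n] *)

Section anova_kernel_lower_bound.
Variables (R : realType) (n : nat) (x y : 'I_n -> R).
Hypotheses (n0 : (0 < n)%N) (xy : proj_regular x y).
Notation I01 := (@I01 R).
Notation I01sq := (@I01sq R).
Notation leb1 := (@leb1 R).
Notation leb2 := (@leb2 R).

Lemma integral_itv_ge (g : R -> R) (a b k : R) : a < b -> 0 <= k ->
  measurable_fun `[a, b] g -> (forall t, a <= t <= b -> k <= g t) ->
  ((k * (b - a))%:E <= \int[leb1]_(t in `[a, b]) (g t)%:E)%E.
Proof.
move=> ab k0 mg kg.
have <- : (\int[leb1]_(t in `[a, b]) (cst k%:E t) = (k * (b - a))%:E)%E.
  rewrite integral_cst; last exact: measurable_itv.
  transitivity (k%:E * lebesgue_measure (`[a, b]%classic : set R))%E => //.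
  by rewrite lebesgue_measure_itv /= lte_fin ab.
apply: ge0_le_integral => //.
- by apply/measurable_EFinP.
Qed.

Lemma Rintegral_I01_ge (g : R -> R) (a b k : R) : a < b -> 0 <= k ->
  0 <= a -> b <= 1 -> leb1.-integrable I01 (EFin \o g) ->
  (forall t, I01 t -> 0 <= g t) -> (forall t, a <= t <= b -> k <= g t) ->
  k * (b - a) <= \int[leb1]_(t in I01) g t.
Proof.
move=> ab k0 a0 b1 ig g0 kg; have mI := @measurable_I01 R.
have sub : `[a, b] `<=` I01.
  by move=> t; rewrite /I01 /= !in_itv/= => /andP[at_ tb]; rewrite (le_trans a0)// (le_trans tb).
have mg : measurable_fun I01 g by apply/measurable_EFinP; exact: measurable_int ig.
rewrite -lee_fin /Rintegral fineK; last exact: integrable_fin_num.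
apply: le_trans (integral_itv_ge ab k0 (measurable_funS mI sub mg) kg) _.
apply: ge0_subset_integral => //.
by apply/measurable_EFinP.
Qed.

Let half_half (k J : R) : k / 2 <= J + J -> k / 4 <= J. Proof. lra. Qed.

Variables (q : R) (q1 : 1 <= q).

Let q0 : 0 <= q. Proof. exact: le_trans q1. Qed.

Let n0' : 0 < n%:R :> R. Proof. by rewrite ltr0n. Qed.

Let F (z : R * R) : R := `|anova_kernel x y z| `^ q.

(** [1/(8n)] is half of the gap [1/(4n)] from [anova_kernel_gap]. *)
Let kappa : R := (8 * n%:R)^-1 `^ q.

Let mF : measurable_fun setT F.
Proof. apply: measurable_normr_powR; exact: measurable_anova_kernel. Qed.

Let F_ge0 z : 0 <= F z. Proof. exact: powR_ge0. Qed.

Let F_le1 z : I01sq z -> `|F z| <= 1.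
Proof.
move=> Iz; rewrite ger0_norm//; apply: (@le_trans _ _ (1 `^ q)); last by rewrite powR1.
by rewrite ge0_ler_powR ?nnegrE//; exact: normr_anova_kernel_le1.
Qed.

Let iF s : I01 s -> leb1.-integrable I01 (EFin \o (fun t => F (s, t))).
Proof.
move=> Is; apply: (@integrable_bounded_I01 _ _ 1).
  exact: (measurable_fun_pair2 s mF).
by move=> t It; apply: F_le1.
Qed.

(** A shift by 1 would leave the unit interval. The only node is the origin, and for [s], [t] in
    [[1/4, 1/2]] the explicit product is at least [1/4], more than the required [1/8]. Staying away
    from 0 matters, since [Kker 0 0] is 0 and not [-1]. *)
Let inner_ge_1 s : (n <= 1)%N -> 4^-1 <= s <= 2^-1 ->
  kappa / 4 <= \int[leb1]_(t in I01) F (s, t).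
Proof.
move=> n1 /andP[s4 s2]; have nE : n = 1%N by apply/eqP; rewrite eqn_leq n1.
have zero (u : 'I_n -> R) : range u = [set (k%:R / n%:R : R) | k in `I_n] ->
    forall j, u j = 0.
  move=> uE j; have : range u (u j) by exists j.
  rewrite uE => -[k /=]; rewrite nE; case: k => // _ <-; by rewrite mul0r.
have [xE yE] := xy.
have K0 (u : R) : 0 < u -> Kker 0 u = u - 1 by move=> u0; rewrite KkerE u0.
have := @Rintegral_I01_ge (fun t => F (s, t)) 4^-1 2^-1 kappa.
rewrite (_ : 2^-1 - 4^-1 = 4^-1 :> R); last by field.
apply.
- lra.
- exact: powR_ge0.
- by rewrite invr_ge0.
- lra.
- by apply: iF; rewrite /I01 /= in_itv/=; apply/andP; split; lra.
- by move=> t _.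
move=> t /andP[t4 t2].
rewrite /F /kappa ge0_ler_powR ?nnegrE ?invr_ge0 ?mulr_ge0//.
rewrite -(average_Kker2 _ n0 xy) (eq_bigr (fun=> (s - 1) * (t - 1))); last first.
  by move=> j _ /=; rewrite (zero x)// (zero y)// !K0//; lra.
rewrite sumr_const card_ord nE mulr1n invr1 mul1r mulr1.
rewrite ger0_norm; last by rewrite mulr_le0//; lra.
have : (2^-1 : R) * 2^-1 <= (1 - s) * (1 - t) by apply: ler_pM; lra.
have : (8^-1 : R) <= 2^-1 * 2^-1 by lra.
nra.
Qed.

Let inner_ge_2 s : (1 < n)%N -> 4^-1 <= s <= 2^-1 ->
  kappa / 4 <= \int[leb1]_(t in I01) F (s, t).
Proof.
move=> n1 s42; have Is : I01 s.
  by rewrite /I01 /= in_itv/=; move: s42 => /andP[? ?]; apply/andP; split; lra.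
have ni0 : 0 < n%:R^-1 :> R by rewrite invr_gt0.
have n2 : n%:R^-1 <= 2^-1 :> R by rewrite lef_pV2 ?posrE// ler_nat.
pose g t := F (s, t).
have mg : measurable_fun setT g by exact: (measurable_fun_pair2 s mF).
have mg' D : measurable_fun D (fun t : R => (g t)%:E).
  by apply: measurable_funTS; exact/measurable_EFinP.
have mh : measurable_fun setT (fun t : R => g (t + n%:R^-1)).
  by apply: (measurableT_comp mg); exact: measurable_funD.
have mh' D : measurable_fun D (fun t : R => (g (t + n%:R^-1))%:E).
  by apply: measurable_funTS; exact/measurable_EFinP.
(* [[0, 1/2]] and its translate by [1/n] both lie in [[0, 1]] but may overlap. Each is therefore
   compared separately with the whole interval, which is why the integral appears twice. *)
suff H : ((kappa / 2)%:E <= \int[leb1]_(t in I01) (g t)%:E + \int[leb1]_(t in I01) (g t)%:E)%E.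
  have gfin : (\int[leb1]_(t in I01) (g t)%:E)%E = (\int[leb1]_(t in I01) g t)%:E.
    rewrite /Rintegral fineK//; apply: integrable_fin_num; first exact: measurable_I01.
    exact: iF.
  by apply: half_half; move: H; rewrite gfin -EFinD lee_fin.
have sub (a b : R) : 0 <= a -> b <= 1 ->
    (\int[leb1]_(t in `[a, b]) (g t)%:E <= \int[leb1]_(t in I01) (g t)%:E)%E.
  move=> a0 b1; apply: ge0_subset_integral => //; first exact: measurable_itv.
  - exact: mg'.
  - by move=> t _; rewrite lee_fin F_ge0.
  - by move=> t; rewrite /I01 /= !in_itv/= => /andP[at_ tb]; rewrite (le_trans a0)// (le_trans tb).
have s1 := sub 0 2^-1 (lexx _) ltac:(lra).
have s2 := sub (0 + n%:R^-1) (2^-1 + n%:R^-1) ltac:(lra) ltac:(lra).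
apply: le_trans (leeD s1 s2).
have e2 : (\int[leb1]_(t in `[(0 + n%:R^-1)%R, (2^-1 + n%:R^-1)%R]) (g t)%:E =
    \int[leb1]_(t in `[0%R, 2^-1%R]) (g (t + n%:R^-1))%:E)%E.
  apply: (@ge0_integral_translation R n%:R^-1 0 2^-1 (fun t => (g t)%:E)).
    exact: mg'.
  by move=> t; rewrite lee_fin F_ge0.
rewrite e2.
have eD : (\int[leb1]_(t in `[0%R, 2^-1%R]) (g t + g (t + n%:R^-1))%:E =
    \int[leb1]_(t in `[0%R, 2^-1%R]) (g t)%:E +
    \int[leb1]_(t in `[0%R, 2^-1%R]) (g (t + n%:R^-1))%:E)%E.
  apply: (@ge0_integralD _ _ _ leb1 _ _ (fun t => (g t)%:E) (fun t => (g (t + n%:R^-1))%:E)).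
  - exact: measurable_itv.
  - by move=> t _; rewrite lee_fin F_ge0.
  - exact: mg'.
  - by move=> t _; rewrite lee_fin F_ge0.
  - exact: mh'.
rewrite -eD.
have -> : kappa / 2 = kappa * (2^-1 - 0) by rewrite subr0.
apply: (@integral_itv_ge (fun t => g t + g (t + n%:R^-1))) => //.
- exact: powR_ge0.
- by apply: measurable_funTS; exact: measurable_funD.
move=> t t02; rewrite /kappa.
have -> : (8 * n%:R)^-1 = (4 * n%:R)^-1 / 2 :> R by field; rewrite gt_eqF.
have gap := anova_kernel_gap n0 xy n1 s42 t02.
rewrite addrC; apply: powR_half_gap gap => //.
Qed.

(** The 16 combines [kappa / 4] from the inner integral with the length [1/4] of the range of
    [s]. *)
Lemma intpow_anova_kernel_ge :
  (8 * n%:R)^-1 `^ q / 16 <= intpow leb2 I01sq q (anova_kernel x y).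
Proof.
rewrite /intpow (Rintegral_I01sq mF F_le1).
have iJ : leb1.-integrable I01 (EFin \o (fun s => \int[leb1]_(t in I01) F (s, t))).
  have ic : leb1.-integrable I01 (EFin \o (cst 1 : R -> R)).
    by apply: (@integrable_bounded_I01 _ _ 1) => [|t _]; rewrite ?normr1//; exact: measurable_cst.
  have := @integrable_kernel _ _ _ _ _ leb1 leb1 I01 I01 (cst 1) F 1 (@measurable_I01 R)
    (@measurable_I01 R) (@leb1_I01 R) ic mF (fun s t Is It => @F_le1 (s, t) (conj Is It)).
  rewrite (_ : (fun z => \int[leb1]_(t in I01) (cst 1 t * F (z, t))) =
    (fun s => \int[leb1]_(t in I01) F (s, t)))//.
  by apply/funext => s; apply: eq_Rintegral => t _; rewrite mul1r.
have := @Rintegral_I01_ge (fun s => \int[leb1]_(t in I01) F (s, t)) 4^-1 2^-1 (kappa / 4).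
rewrite (_ : kappa / 4 * (2^-1 - 4^-1) = (8 * n%:R)^-1 `^ q / 16); last first.
  by rewrite /kappa; field.
apply => //.
- lra.
- by rewrite divr_ge0// powR_ge0.
- lra.
- by move=> s _; apply: Rintegral_ge0 => t _; exact: F_ge0.
move=> s s42; have [n1|n1] := leqP n 1; first exact: inner_ge_1.
exact: inner_ge_2.
Qed.

End anova_kernel_lower_bound.

(** * The worst-case error *)

Section weighted_norm.
Variable R : realType.

(** The two-term inequality is used twice: the first two terms are merged into one pair, formed by
    their [p]-norm and [q]-norm. *)
Lemma hoelder3 (a1 a2 a3 b1 b2 b3 p q : R) :
  0 <= a1 -> 0 <= a2 -> 0 <= a3 -> 0 <= b1 -> 0 <= b2 -> 0 <= b3 ->
  0 < p -> 0 < q -> p^-1 + q^-1 = 1 ->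
  a1 * b1 + a2 * b2 + a3 * b3 <=
  (a1 `^ p + a2 `^ p + a3 `^ p) `^ p^-1 * (b1 `^ q + b2 `^ q + b3 `^ q) `^ q^-1.
Proof.
move=> a10 a20 a30 b10 b20 b30 p0 q0 pq.
have powVK (u r : R) : 0 <= u -> 0 < r -> (u `^ r^-1) `^ r = u.
  by move=> u0 r0; rewrite -powRrM mulVf ?gt_eqF// powRr1.
rewrite -[X in (X + a3 `^ p) `^ _](@powVK _ p) ?addr_ge0 ?powR_ge0//.
rewrite -[X in (X + b3 `^ q) `^ _](@powVK _ q) ?addr_ge0 ?powR_ge0//.
apply: le_trans (hoelder2 _ _ _ _ p0 q0 pq); rewrite ?powR_ge0// lerD2r.
exact: hoelder2.
Qed.

(** Since [N / 0 = 0] and [0 ^ r = 0], the formula remains correct for an absent component. *)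
Lemma wtermE (r g N : R) : 0 < r -> 0 <= g -> wterm r g N = (N / g) `^ r.
Proof.
move=> r0; rewrite /wterm le_eqVlt => /predU1P[<-|->//].
by rewrite ltxx invr0 mulr0 powR0// gt_eqF.
Qed.

Lemma wterm_ge0 (r g N : R) : 0 <= wterm r g N.
Proof. by rewrite /wterm; case: ifP => // _; exact: powR_ge0. Qed.

Lemma powRV_le1 (r u : R) : 0 < r -> 0 <= u -> (u `^ r^-1 <= 1) = (u <= 1).
Proof.
move=> r0 u0; have rV0 : 0 <= r^-1 by rewrite invr_ge0 ltW.
apply/idP/idP => u1.
  rewrite -[leLHS](powRr1 u0) -[in leLHS](mulVf (lt0r_neq0 r0)) powRrM.
  apply: (@le_trans _ _ (1 `^ r)); last by rewrite powR1.
  by rewrite ge0_ler_powR ?nnegrE ?powR_ge0// ltW.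
apply: (@le_trans _ _ (1 `^ r^-1)); last by rewrite powR1.
by rewrite ge0_ler_powR ?nnegrE.
Qed.

(** Hoelder's inequality for the splitting [N * d = (N / g) * (g * d)], valid at [g = 0] because
    then [N = 0]. The constant component is dropped, as it only increases the norm. For [p = +oo]
    the norm bound says [N <= g] termwise. *)
Lemma Fnorm_dual (p : \bar R) (g0 g1 g2 g3 c N1 N2 N3 d1 d2 d3 : R) :
  (1%:E < p)%E -> 0 <= g0 -> 0 <= g1 -> 0 <= g2 -> 0 <= g3 ->
  0 <= N1 -> 0 <= N2 -> 0 <= N3 -> 0 <= d1 -> 0 <= d2 -> 0 <= d3 ->
  (g1 = 0 -> N1 = 0) -> (g2 = 0 -> N2 = 0) -> (g3 = 0 -> N3 = 0) ->
  Fnorm p g0 g1 g2 g3 c N1 N2 N3 <= 1 ->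
  N1 * d1 + N2 * d2 + N3 * d3 <=
  ((g1 * d1) `^ pstar p + (g2 * d2) `^ pstar p + (g3 * d3) `^ pstar p) `^ (pstar p)^-1.
Proof.
move=> p1 g00 g10 g20 g30 N10 N20 N30 d10 d20 d30 z1 z2 z3.
have split3 (g N d : R) : 0 <= g -> (g = 0 -> N = 0) -> N * d = N / g * (g * d).
  move=> g_ge0 z; have [g0'|gN0] := eqVneq g 0.
    by rewrite (z g0') !mul0r.
  by rewrite mulrA divfK.
case: p p1 => [r| |]//= p1; last first.
  have le_g (g N : R) : 0 <= g -> (g = 0 -> N = 0) -> wmax g N <= 1 -> N <= g.
    rewrite /wmax le_eqVlt => /predU1P[<-|g_gt0]; first by move=> ->.
    by rewrite g_gt0 ler_pdivrMr// mul1r.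
  rewrite !ge_max => /andP[/andP[_ w1] /andP[w2 w3]].
  rewrite invr1 !powRr1 ?addr_ge0 ?mulr_ge0//.
  by rewrite !lerD// ler_wpM2r// le_g.
rewrite lte_fin in p1; have r0 : 0 < r by rewrite (lt_trans ltr01).
have r1 : r - 1 != 0 by rewrite subr_eq0 gt_eqF.
have q0 : 0 < r / (r - 1) by rewrite divr_gt0// subr_gt0.
rewrite powRV_le1 ?addr_ge0 ?wterm_ge0// => w1.
rewrite (split3 _ _ _ g10 z1) (split3 _ _ _ g20 z2) (split3 _ _ _ g30 z3).
have pq : r^-1 + (r / (r - 1))^-1 = 1.
  by field; rewrite r1 gt_eqF.
apply: le_trans (hoelder3 _ _ _ _ _ _ r0 q0 pq) _; rewrite ?mulr_ge0 ?invr_ge0//.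
rewrite -[leRHS]mul1r ler_wpM2r ?powR_ge0//.
rewrite powRV_le1 ?addr_ge0 ?powR_ge0// -!wtermE//.
by apply: le_trans w1; rewrite -!addrA lerDr wterm_ge0.
Qed.

Lemma Fnorm_single_le1 (p : \bar R) (g0 g1 g2 g3 N : R) :
  (1%:E < p)%E -> 0 <= g0 -> 0 <= g1 -> 0 <= g2 -> 0 <= g3 -> 0 <= N -> N <= g3 ->
  Fnorm p g0 g1 g2 g3 0 0 0 N <= 1.
Proof.
move=> p1 g00 g10 g20 g30 N0 Ng.
have Ng1 : N / g3 <= 1.
  move: g30; rewrite le_eqVlt => /predU1P[<-|g3_gt0]; first by rewrite invr0 mulr0.
  by rewrite ler_pdivrMr// mul1r.
case: p p1 => [r| |]//= p1; last first.
  by rewrite /wmax !mul0r !if_same !ge_max ler01/=; case: ifP.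
rewrite lte_fin in p1; have r0 : 0 < r by rewrite (lt_trans ltr01).
rewrite !wtermE// !mul0r powR0 ?gt_eqF// !add0r -powRrM mulfV ?gt_eqF// powRr1//.
by rewrite divr_ge0.
Qed.

End weighted_norm.

(** * The worst-case error in terms of the norms of [D1] and [D12] *)

Section worst_case_error.
Variables (R : realType) (p : \bar R) (n : nat) (x y : 'I_n -> R).
Variables (g0 g1 g2 g12 : R).
Hypotheses (p1 : (1%:E < p)%E) (g00 : 0 <= g0) (g10 : 0 <= g1) (g20 : 0 <= g2)
  (g120 : 0 <= g12) (n0 : (0 < n)%N) (xy : proj_regular x y).
Notation I01 := (@I01 R).
Notation I01sq := (@I01sq R).
Notation leb1 := (@leb1 R).
Notation leb2 := (@leb2 R).
Notation q := (pstar p).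

Let q1 : 1 <= q. Proof. exact: pstar_ge1. Qed.
Let q_gt0 : 0 < q. Proof. exact: lt_le_trans q1. Qed.
Let q_neq0 : q != 0. Proof. by rewrite gt_eqF. Qed.

Let mI1 : measurable (I01 : set (measurableTypeR R)).
Proof. exact: measurable_I01. Qed.

Let mI2 : measurable (I01sq : set (measurableTypeR R * measurableTypeR R)).
Proof. exact: measurable_I01sq. Qed.

Let sawtooth_le t : I01 t -> `|sawtooth n t| <= 1.
Proof. by move=> /I01P; exact: normr_sawtooth_le1. Qed.

Let kernel_le z : I01sq z -> `|anova_kernel x y z| <= 1.
Proof. exact: normr_anova_kernel_le1. Qed.

Let ms (D : set R) : measurable_fun D (sawtooth n).
Proof. by apply: measurable_funTS; exact: measurable_sawtooth. Qed.

Let mk (D : set (R * R)) : measurable_fun D (anova_kernel x y).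
Proof. by apply: measurable_funTS; exact: measurable_anova_kernel. Qed.

Lemma Ldisc_powR (s : R) : 0 < s -> Ldisc s x y `^ s = intpow leb2 I01sq s (discr x y).
Proof.
move=> s0; rewrite /Ldisc /Lp2 (fine_Lnorm_restrict leb2 I01sq)//.
by rewrite -powRrM mulVf ?gt_eqF// powRr1// intpow_ge0.
Qed.

Lemma Lp1_0 : Lp1 p (fun=> 0) = 0%E.
Proof.
rewrite /Lp1 -(@Lnorm0 _ _ _ leb1 p); last by rewrite gt_eqF// (lt_trans _ p1)// lte_fin.
by apply: eq_Lnorm => t /=; rewrite patchE; case: ifP.
Qed.

Lemma Lp2_0 : Lp2 p (fun=> 0) = 0%E.
Proof.
rewrite /Lp2 -(@Lnorm0 _ _ _ leb2 p); last by rewrite gt_eqF// (lt_trans _ p1)// lte_fin.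
by apply: eq_Lnorm => t /=; rewrite patchE; case: ifP.
Qed.

Lemma wc_error_le_intpow : (wc_error p g0 g1 g2 g12 x y <=
  ((g1 `^ q * intpow leb1 I01 q (sawtooth n) + g2 `^ q * intpow leb1 I01 q (sawtooth n)
    + g12 `^ q * intpow leb2 I01sq q (anova_kernel x y)) `^ q^-1)%:E)%E.
Proof.
apply: ge_ereal_sup => _ [c [h1 [h2 [h12 [[[_ z1 z2 z12] [[mh1 L1] [mh2 L2] [mh12 L12] F1]] ->]]]]].
rewrite lee_fin.
have i1 := Lp_integrable mI1 (@leb1_I01 R) p1 mh1 L1.
have i2 := Lp_integrable mI1 (@leb1_I01 R) p1 mh2 L2.
have i12 := Lp_integrable mI2 (@leb2_I01sq R) p1 mh12 L12.
rewrite (QMC_error_formula c n0 xy i1 i2 i12) normrN.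
have H1 := hoelder_Rintegral mI1 (@leb1_I01 R) p1 mh1 L1 (@ms I01) sawtooth_le.
have H2 := hoelder_Rintegral mI1 (@leb1_I01 R) p1 mh2 L2 (@ms I01) sawtooth_le.
have H12 := hoelder_Rintegral mI2 (@leb2_I01sq R) p1 mh12 L12 (@mk I01sq) kernel_le.
apply: le_trans (ler_normD _ _) _.
apply: le_trans (lerD (ler_normD _ _) (lexx _)) _.
apply: le_trans (lerD (lerD H1 H2) H12) _.
apply: le_trans (Fnorm_dual p1 g00 g10 g20 g120 _ _ _ _ _ _ _ _ _ F1) _;
  rewrite ?powR_ge0// ?fine_ge0 ?Lnorm_ge0//.
- by move=> /z1 h0; rewrite (_ : h1 = fun=> 0) ?Lp1_0//; exact/funext.
- by move=> /z2 h0; rewrite (_ : h2 = fun=> 0) ?Lp1_0//; exact/funext.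
- by move=> /z12 h0; rewrite (_ : h12 = fun=> 0) ?Lp2_0//; exact/funext.
rewrite !powRM ?powR_ge0// -!powRrM mulVf// !powRr1 ?intpow_ge0//.
Qed.

(** The test function has a single component, the extremal function for [D12] scaled to norm at most
    [g12]. Positivity of the integral is needed for the exponent [q^-1 - 1] in its normalisation. *)
Lemma wc_error_ge_intpow : 0 < intpow leb2 I01sq q (anova_kernel x y) ->
  ((g12 * intpow leb2 I01sq q (anova_kernel x y) `^ q^-1)%:E <=
   wc_error p g0 g1 g2 g12 x y)%E.
Proof.
move=> A0.
pose h : R * R -> R := extremal leb2 I01sq q g12 (anova_kernel x y).
have mh : measurable_fun I01sq h := measurable_extremal leb2 q g12 (@mk I01sq).
have Lh := Lnorm_extremal mI2 (@leb2_I01sq R) p1 g120 (@mk I01sq) kernel_le A0.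
have Loo : (Lp2 p h < +oo)%E by apply: le_lt_trans Lh _; rewrite ltry.
have m0 D : measurable_fun D (fun _ : R => 0 : R) by exact: measurable_cst.
have i0 : leb1.-integrable I01 (EFin \o (fun _ : R => 0 : R)).
  by apply: (@integrable_bounded_I01 _ _ 0) => // t _; rewrite normr0.
have ih := Lp_integrable mI2 (@leb2_I01sq R) p1 mh Loo.
apply: ereal_sup_ubound; exists 0, (fun=> 0), (fun=> 0), h; split.
  split; split => //.
  (* For [g12 = 0] the extremal function vanishes identically, as the unit ball demands. *)
  - by move=> g0' t; rewrite /h /extremal g0' !mul0r.
  - by split => //; rewrite Lp1_0 ltry.
  - by split => //; rewrite Lp1_0 ltry.
  rewrite normr0 Lp1_0 /=; apply: Fnorm_single_le1 => //.
    by rewrite fine_ge0// Lnorm_ge0.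
  by rewrite -lee_fin fineK ?ge0_fin_numE// Lnorm_ge0.
congr EFin; rewrite (QMC_error_formula 0 n0 xy i0 i0 ih) normrN.
have int0 : \int[leb1]_(t in I01) ((fun=> 0 : R) t * sawtooth n t) = 0.
  rewrite (_ : (fun t => _) = fun=> 0) ?Rintegral_cst ?mul0r//.
  by apply/funext => t; rewrite mul0r.
rewrite int0 !add0r.
rewrite (integral_extremal mI2 (@leb2_I01sq R) _ q1 (@mk I01sq) kernel_le A0).
by rewrite ger0_norm// mulr_ge0// powR_ge0.
Qed.

End worst_case_error.

Theorem theorem2 (R : realType) (p : \bar R) (hp : (1%:E < p)%E) :
  (forall (g0 g1 g2 g12 : R), 0 <= g0 -> 0 <= g1 -> 0 <= g2 -> 0 <= g12 ->
   forall (n : nat) (x y : 'I_n -> R), (0 < n)%N -> proj_regular x y ->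
   let ps := pstar p in
   (wc_error p g0 g1 g2 g12 x y <=
     (n%:R^-1 *
      ((g1 `^ ps + g2 `^ ps) / (ps + 1)
       + 3 `^ (ps - 1) * g12 `^ ps
         * (2 / (ps + 1) ^+ 2 + (n%:R * Ldisc ps x y) `^ ps)) `^ ps^-1)%:E)%E)
  /\
  (exists C : R, 0 < C /\
   forall (g0 g1 g2 g12 : R), 0 <= g0 -> 0 <= g1 -> 0 <= g2 -> 0 <= g12 ->
   forall (n : nat) (x y : 'I_n -> R), (0 < n)%N -> proj_regular x y ->
   ((C * g12 * Ldisc (pstar p) x y)%:E <= wc_error p g0 g1 g2 g12 x y)%E).
Proof.
have q1 := pstar_ge1 hp; have q_gt0 : 0 < pstar p := lt_le_trans ltr01 q1.
have qV0 : 0 <= (pstar p)^-1 by rewrite invr_ge0 ltW.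
have q10 : pstar p + 1 != 0 by rewrite gt_eqF// addr_gt0.
split.
  move=> g0 g1 g2 g12 g00 g10 g20 g120 n x y n0 xy; cbv zeta; set q := pstar p.
  apply: le_trans (wc_error_le_intpow hp g00 g10 g20 g120 n0 xy) _.
  rewrite lee_fin -/q intpow_sawtooth//.
  have nR : 0 < n%:R :> R by rewrite ltr0n.
  have L0 : 0 <= Ldisc q x y by rewrite fine_ge0// Lnorm_ge0.
  have q1p : 0 <= q + 1 by rewrite addr_ge0// ltW.
  (* The factor [1/n] is moved inside the root, so that both sides are [q]-th roots and only their
     radicands are compared. *)
  have nV : n%:R^-1 = (n%:R `^ (- q)) `^ q^-1.
    by rewrite -powRrM mulNr mulfV ?gt_eqF// powR_inv1// ltW.
  rewrite nV -powRM ?powR_ge0//; last first.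
    exact: addr_ge0 (divr_ge0 (addr_ge0 (powR_ge0 _ _) (powR_ge0 _ _)) q1p)
      (mulr_ge0 (mulr_ge0 (powR_ge0 _ _) (powR_ge0 _ _))
         (addr_ge0 (divr_ge0 (ler0n R 2) (exprn_ge0 2 q1p)) (powR_ge0 _ _))).
  have lhs0 : 0 <= g1 `^ q * (n%:R `^ (- q) / (q + 1)) + g2 `^ q * (n%:R `^ (- q) / (q + 1)) +
      g12 `^ q * intpow (@leb2 R) (@I01sq R) q (anova_kernel x y).
    by rewrite !addr_ge0// mulr_ge0 ?powR_ge0 ?intpow_ge0// divr_ge0// powR_ge0.
  suff H : g1 `^ q * (n%:R `^ (- q) / (q + 1)) + g2 `^ q * (n%:R `^ (- q) / (q + 1)) +
      g12 `^ q * intpow (@leb2 R) (@I01sq R) q (anova_kernel x y) <=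
      n%:R `^ (- q) * ((g1 `^ q + g2 `^ q) / (q + 1) + 3 `^ (q - 1) * g12 `^ q *
        (2 / (q + 1) ^+ 2 + (n%:R * Ldisc q x y) `^ q)).
    by rewrite ge0_ler_powR ?nnegrE// (le_trans lhs0 H).
  have K := intpow_anova_kernel_le n0 xy q1.
  rewrite (powRM _ (ltW nR) L0) Ldisc_powR//.
  have nn : n%:R `^ (- q) * n%:R `^ q = 1.
    by rewrite powRN mulVf// powR_eq0 gt_eqF.
  have := ler_wpM2l (powR_ge0 g12 q) K; rewrite -/q => K'.
  apply: le_trans (lerD (lexx _) K') _.
  rewrite le_eqVlt; apply/orP; left; apply/eqP.
  set D := intpow _ _ _ _.
  transitivity (n%:R `^ (- q) * ((g1 `^ q + g2 `^ q) / (q + 1) + 3 `^ (q - 1) * g12 `^ q *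
     (2 / (q + 1) ^+ 2)) + 3 `^ (q - 1) * g12 `^ q * D * (n%:R `^ (- q) * n%:R `^ q)).
    by rewrite nn; field.
  by field.
pose q := pstar p; have q1p : 0 <= q + 1 by rewrite addr_ge0// ltW.
(* Chosen so that [intpow_discr_le] becomes [c0 * A], with [A] the integral of [|D12| ^ q], once its
   additive term is absorbed by [n ^ (-q) <= 16 * 8 ^ q * A], the lower bound on [A] read
   backwards. *)
pose c0 : R := 3 `^ (q - 1) * (1 + 2 * (16 * 8 `^ q) / (q + 1) ^+ 2).
have c00 : 0 < c0.
  rewrite mulr_gt0 ?powR_gt0// ltr_pwDl//.
  exact: divr_ge0 (mulr_ge0 (ler0n R 2) (mulr_ge0 (ler0n R 16) (powR_ge0 _ _)))
    (exprn_ge0 2 q1p).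
exists (c0 `^ q^-1)^-1; split; first by rewrite invr_gt0 powR_gt0.
move=> g0 g1 g2 g12 g00 g10 g20 g120 n x y n0 xy.
have nR : 0 < n%:R :> R by rewrite ltr0n.
have K := intpow_anova_kernel_ge n0 xy q1.
set A := intpow _ _ _ _ in K.
have A0 : 0 < A by apply: lt_le_trans K; rewrite divr_gt0// powR_gt0// invr_gt0 mulr_gt0.
apply: le_trans (wc_error_ge_intpow hp g00 g10 g20 g120 n0 xy A0).
rewrite lee_fin -/A -/q.
have nA : n%:R `^ (- q) <= 16 * 8 `^ q * A.
  move: K; rewrite -/q -(powR_inv1 (mulr_ge0 (ler0n R 8) (ltW nR))) -powRrM mulN1r.
  rewrite (powRM _ (ler0n R 8) (ltW nR)) => {}K.
  have e8 : 8 `^ q * 8 `^ (- q) = 1 :> R.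
    by rewrite powRN mulfV// powR_eq0.
  have := ler_wpM2l (mulr_ge0 (ler0n R 16) (powR_ge0 8 q)) K.
  rewrite [X in X <= _ -> _](_ : _ = 8 `^ q * 8 `^ (- q) * n%:R `^ (- q)); last by field.
  by rewrite e8 mul1r.
have D0 : intpow (@leb2 R) (@I01sq R) q (discr x y) <= c0 * A.
  apply: le_trans (intpow_discr_le n0 xy q1) _.
  rewrite -/q -/A.
  have -> : c0 * A = 3 `^ (q - 1) * (A + 2 * (16 * 8 `^ q * A / (q + 1) ^+ 2)).
    by rewrite /c0; ring.
  rewrite (ler_wpM2l (powR_ge0 _ _))// lerD2l (ler_wpM2l (ler0n R 2))//.
  by rewrite ler_wpM2r// invr_ge0 exprn_ge0.
have LE : Ldisc q x y <= c0 `^ q^-1 * A `^ q^-1.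
  rewrite -powRM ?(ltW c00) ?(ltW A0)//.
  have L0 : 0 <= Ldisc q x y by rewrite fine_ge0// Lnorm_ge0.
  rewrite -[leLHS](powRr1 L0) -(mulfV (lt0r_neq0 q_gt0)) powRrM Ldisc_powR//.
  by rewrite ge0_ler_powR// nnegrE ?intpow_ge0// mulr_ge0// ltW.
rewrite mulrAC mulrC ler_wpM2l// mulrC ler_pdivrMr ?powR_gt0//.
by rewrite mulrC.
Qed.
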